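(* Let $\bar x\in E$ be a feasible point and put $\mathcal B(\bar x)=\{i\in\{1,\dots,N\}: G_i(\bar x)=0\}$ and $\mathcal A(\bar x)=\{i\in\{1,\dots,n\}:\langle g_i,\bar x\rangle=a_i\}$. Assume the existence of $\tilde x\in L^p(\mu)$ satisfying $$x_a<\tilde x<x_b\ \ \mu\text{-a.e. on }\Omega,\qquad \langle g_i,\tilde x\rangle\le a_i\ \ \forall i=1,\dots,n,$$ $$G_i'(\bar x)(\tilde x-\bar x)<0\ \ \forall i\in\mathcal B(\bar x),\qquad \langle h_j,\tilde x\rangle=b_j\ \ \forall j=1,\dots,m.$$ Then $$\mathcal N_E(\bar x)=\mathcal N_K(\bar x)+\mathcal N_P(\bar x)+\mathcal N_Q(\bar x).$$ Now assume additionally that $\bar x$ is a local minimizer of $f$ on $E$ (local with respect to the norm of $L^p(\mu)$). Then there exist $\zeta\in L^{p'}(\mu)$, $\alpha_i\ge0$ for $i\in\mathcal A(\bar x)$, $\beta_j\in\mathbb R$ for $j=1,\dots,m$, and $\gamma_i\ge0$ for $i\in\mathcal B(\bar x)$ such that $$f'(\bar x)+\zeta+\sum_{i\in\mathcal A(\bar x)}\alpha_i g_i+\sum_{j=1}^m\beta_j h_j+\sum_{i\in\mathcal B(\bar x)}\gamma_i G_i'(\bar x)=0,$$ $$\zeta\le0\ \ \mu\text{-a.e. on }\{x_a=\bar x<x_b\},\qquad \zeta=0\ \ \mu\text{-a.e. on }\{x_a<\bar x<x_b\},\qquad \zeta\ge0\ \ \mu\text{-a.e. on }\{x_a<\bar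 x=x_b\}.$$ The multiplier can be split as $\zeta=\zeta_b-\zeta_a$ with $\zeta_b=\max(\zeta,0)$, $\zeta_a=\max(-\zeta,0)$, and $\mu$-a.e. it holds that $\zeta_a,\zeta_b\ge0$ on $\Omega$, $\zeta_a=0$ on $\{x_a<\bar x\}$, and $\zeta_b=0$ on $\{\bar x<x_b\}$.
   Context: Let $(\Omega,\Sigma,\mu)$ be a $\sigma$-finite measure space, $p\in[1,\infty]$ and $p'\in[1,\infty]$ the conjugate exponent, $1/p+1/p'=1$ (with $1/\infty=0$). All function spaces are real, and $\langle y,x\rangle=\int_\Omega yx\,d\mu$ for $y\in L^{p'}(\mu)$, $x\in L^p(\mu)$. For $p<\infty$ one identifies $L^p(\mu)^*=L^{p'}(\mu)$. Let $x_a,x_b:\Omega\to[-\infty,\infty]$ be measurable, let $n,m,N$ be nonnegative integers, and let $g_1,\dots,g_n,h_1,\dots,h_m\in L^{p'}(\mu)$, $a_i,b_j\in\mathbb R$. Put $$K=\{x\in L^p(\mu): x_a\le x\le x_b\ \mu\text{-a.e.}\},\qquad P=\{x\in L^p(\mu): \langle g_i,x\rangle\le a_i\ (1\le i\le n),\ \langle h_j,x\rangle=b_j\ (1\le j\le m)\}.$$ Let $f:L^p(\mu)\to\mathbb R$ be Fréchet differentiable and let $G_1,\dots,G_N:L^p(\mu)\to\mathbb R$ be continuously Fréchet differentiable; in the case $p=\infty$ it is additionally required that $f'(x)\in L^1(\mu)$ and $G_i'(x)\in L^1(\mu)$, $i=1,\dots,N$ (with $L^1(\mu)$ viewed as a subspace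 of $L^\infty(\mu)^*$), for all $x\in K\cap P$. Put $$Q=\{x\in L^p(\mu): G_i(x)\le0\ \forall i=1,\dots,N\},\qquad E=K\cap P\cap Q.$$ For a closed set $C\subset L^p(\mu)$ and $x\in C$, the (Bouligand) tangent cone is $\mathcal T_C(x)=\{d\in L^p(\mu): \exists (x_k)\subset C,\ (t_k)\subset(0,\infty),\ x_k\to x,\ t_k\searrow0,\ (x_k-x)/t_k\to d\}$ (norm convergence in $L^p(\mu)$), and the normal cone is $\mathcal N_C(x)=\{y\in L^{p'}(\mu): \langle y,d\rangle\le0\ \forall d\in\mathcal T_C(x)\}$. In particular, for $p=\infty$ the normal cone is by definition a subset of the predual $L^1(\mu)$. Notation such as $\{x_a=\bar x<x_b\}$ denotes $\{\omega\in\Omega: x_a(\omega)=\bar x(\omega)<x_b(\omega)\}$. *)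

(* Defs.v *)
From HB Require Import structures.
From mathcomp Require Import all_boot all_order all_algebra.
From mathcomp Require Import all_classical all_reals all_analysis.
From mathcomp Require Import measurable_realfun ess_sup_inf.

Set Implicit Arguments.
Unset Strict Implicit.
Unset Printing Implicit Defensive.

Import Order.TTheory GRing.Theory Num.Theory.
Import numFieldNormedType.Exports.

Local Open Scope classical_set_scope.
Local Open Scope ring_scope.

(* Values of a representative, with type R instead of measurableTypeR R. *)
Definition Lspace_fun d (T : measurableType d) (R : realType)
    (mu : {measure set T -> \bar R}) (p : \bar R) (p1 : (1 <= p)%E)
    (u : LspaceType mu p1) : T -> R := u.
Coercion Lspace_fun : LspaceType >-> Funclass.

(* LspaceType mu p1 is the library's quotient of the p-integrable functions
   by equality mu-almost everywhere, without algebraic structure; it is made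
   here into a normed space. *)
Section Lspace_normed.
Context d (T : measurableType d) (R : realType).
Variables (mu : {measure set T -> \bar R}) (p : \bar R) (p1 : (1 <= p)%E).

Local Notation Lp := (LspaceType mu p1).

Lemma eq_Lnorm_ae (f g : T -> R) :
  measurable_fun [set: T] f -> measurable_fun [set: T] g ->
  (\forall t \ae mu, f t = g t) ->
  ('N[mu]_p[EFin \o f] = 'N[mu]_p[EFin \o g])%E.
Proof.
move=> mf mg fg; rewrite unlock /Lnorm; case: p p1 => [r _|_|//].
- have mpow (h : T -> R) : measurable_fun setT h ->
      measurable_fun setT (fun t => (`|(EFin \o h) t| `^ r)%E).
    move=> mh; apply: (measurableT_comp (measurable_poweR r)).
    by apply: measurableT_comp => //; exact/measurable_EFinP.
  congr (_ `^ _)%E; apply: ge0_ae_eq_integral => //.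
  + exact: mpow.
  + exact: mpow.
  + by move=> t _; exact: poweR_ge0.
  + by move=> t _; exact: poweR_ge0.
  + by near=> t => _ /=; rewrite (near fg t).
- case: ifP => // _; apply/eq_ess_sup.
  by near=> t; rewrite /= (near fg t).
Unshelve. all: by end_near. Qed.

Let mfun_of (f : LfunType mu p1) : {mfun T >-> measurableTypeR R} :=
  HB.pack (f : T -> measurableTypeR R)
    (isMeasurableFun.Build d _ T (measurableTypeR R) f (measurable_funPT f)).

Let class_of (f : LfunType mu p1) : {mfun_ mu, T >-> measurableTypeR R} :=
  \pi_({mfun_ mu, T >-> measurableTypeR R})%qT (mfun_of f).

Let class_ofE (f : LfunType mu p1) :
  \forall t \ae mu, (class_of f : T -> R) t = f t.
Proof.
have : (repr (class_of f) = mfun_of f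
  %[mod {mfun_ mu, T >-> measurableTypeR R}])%qT by rewrite reprK.
move/eqP; rewrite eqmodE => /asboolP; apply: filterS => t; exact.
Qed.

Let class_of_finite (f : LfunType mu p1) : finite_norm mu p (class_of f).
Proof.
rewrite /finite_norm (@eq_Lnorm_ae _ f); first exact: Lfunction_finite.
- exact: (measurable_funPT (repr (class_of f))).
- exact: measurable_funPT.
- exact: class_ofE.
Qed.

Definition Lspace_of (f : LfunType mu p1) : Lp :=
  HB.pack (class_of f) (isFinLebesgue.Build d T R mu p p1 _ (class_of_finite f)).

Lemma Lspace_ofE (f : LfunType mu p1) :
  \forall t \ae mu, Lspace_of f t = f t.
Proof. exact: class_ofE. Qed.

Lemma measurable_Lspace (u : Lp) : measurable_fun [set: T] u.
Proof. exact: (measurable_funPT (repr (LebesgueSpace.sort u))). Qed.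

Lemma Lspace_Lfun (u : Lp) : (u : T -> R) \in Lfun mu p.
Proof.
apply/andP; split; rewrite inE; first exact: measurable_Lspace.
exact: Lebesgue_finite.
Qed.

Definition Lfun_of (u : Lp) : LfunType mu p1 := Lfun_Sub p1 (Lspace_Lfun u).

Lemma Lspace_eqP (u v : Lp) :
  u = v <-> \forall t \ae mu, u t = v t.
Proof.
split=> [->|uv]; first exact: aeW.
case: u v uv => [u [[uf]]] [v [[vf]]] uv.
suff uvE : u = v by case: _ / uvE in vf uv *; rewrite (Prop_irrelevance uf vf).
suff : (u == v %[mod {mfun_ mu, T >-> measurableTypeR R}])%qT.
  by move=> /eqP; rewrite -[u]reprK -[v]reprK !reprK.
apply/ae_eqP; apply: filterS uv => t uvt _; exact: uvt.
Qed.

HB.instance Definition _ := gen_eqMixin Lp.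
HB.instance Definition _ := gen_choiceMixin Lp.

Let zero : Lp := Lspace_of 0.
Let opp (u : Lp) : Lp := Lspace_of (- Lfun_of u).
Let add (u v : Lp) : Lp := Lspace_of (Lfun_of u + Lfun_of v).
Let scale (a : R) (u : Lp) : Lp := Lspace_of (a *: Lfun_of u).

Let zeroE : \forall t \ae mu, zero t = 0.
Proof. exact: Lspace_ofE. Qed.

Let oppE u : \forall t \ae mu, opp u t = - u t.
Proof. exact: Lspace_ofE. Qed.

Let addE u v :
  \forall t \ae mu, add u v t = u t + v t.
Proof. exact: Lspace_ofE. Qed.

Let scaleE a u : \forall t \ae mu, scale a u t = a * u t.
Proof. exact: Lspace_ofE. Qed.

Let addA : associative add.
Proof.
move=> u v w; apply/Lspace_eqP; near=> t.
by rewrite (near (addE u (add v w)) t)// (near (addE v w) t)//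
  (near (addE (add u v) w) t)// (near (addE u v) t)// addrA.
Unshelve. all: by end_near. Qed.

Let addC : commutative add.
Proof.
move=> u v; apply/Lspace_eqP; near=> t.
by rewrite (near (addE u v) t)// (near (addE v u) t)// addrC.
Unshelve. all: by end_near. Qed.

Let add0 : left_id zero add.
Proof.
move=> u; apply/Lspace_eqP; near=> t.
by rewrite (near (addE zero u) t)// (near zeroE t)// add0r.
Unshelve. all: by end_near. Qed.

Let addN : left_inverse zero opp add.
Proof.
move=> u; apply/Lspace_eqP; near=> t.
by rewrite (near (addE (opp u) u) t)// (near (oppE u) t)// (near zeroE t)// addNr.
Unshelve. all: by end_near. Qed.

HB.instance Definition _ := GRing.isZmodule.Build Lp addA addC add0 addN.

Let scaleA a b u : scale a (scale b u) = scale (a * b) u.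
Proof.
apply/Lspace_eqP; near=> t.
by rewrite (near (scaleE a (scale b u)) t)// (near (scaleE b u) t)//
  (near (scaleE (a * b) u) t)// mulrA.
Unshelve. all: by end_near. Qed.

Let scale1 : left_id 1 scale.
Proof.
move=> u; apply/Lspace_eqP; near=> t.
by rewrite (near (scaleE 1 u) t)// mul1r.
Unshelve. all: by end_near. Qed.

Let scaleDr : right_distributive scale +%R.
Proof.
move=> a u v; apply/Lspace_eqP; near=> t.
by rewrite (near (scaleE a (add u v)) t)// (near (addE u v) t)//
  (near (addE (scale a u) (scale a v)) t)// (near (scaleE a u) t)//
  (near (scaleE a v) t)// mulrDr.
Unshelve. all: by end_near. Qed.

Let scaleDl u : {morph scale^~ u : a b / a + b}.
Proof.
move=> a b; apply/Lspace_eqP; near=> t.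
by rewrite (near (scaleE (a + b) u) t)//
  (near (addE (scale a u) (scale b u)) t)// (near (scaleE a u) t)//
  (near (scaleE b u) t)// mulrDl.
Unshelve. all: by end_near. Qed.

HB.instance Definition _ :=
  GRing.Zmodule_isLmodule.Build R Lp scaleA scale1 scaleDr scaleDl.

Definition Lspace_norm (u : Lp) : R := fine ('N[mu]_p[EFin \o u])%E.

Let Lspace_norm_of (f : LfunType mu p1) :
  Lspace_norm (Lspace_of f) = fine ('N[mu]_p[EFin \o f])%E.
Proof.
congr fine; apply: eq_Lnorm_ae; last exact: Lspace_ofE.
- exact: measurable_Lspace.
- exact: measurable_funPT.
Qed.

Let normD u v : Lspace_norm (u + v) <= Lspace_norm u + Lspace_norm v.
Proof. by rewrite Lspace_norm_of; exact: (ler_LnormD (Lfun_of u) (Lfun_of v)). Qed.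

Let normZ a u : Lspace_norm (a *: u) = `|a| * Lspace_norm u.
Proof.
rewrite Lspace_norm_of.
rewrite [X in fine X](LnormZ (Lfun_of u) a) fineM//.
by rewrite -finite_norm_fine.
Qed.

Let norm0_eq0 u : Lspace_norm u = 0 -> u = 0.
Proof.
move=> /(@fine_Lnormr_eq0 _ _ _ mu p p1 (Lfun_of u)) u0.
apply/Lspace_eqP; near=> t.
by rewrite (near zeroE t)//; apply: (near u0 t).
Unshelve. all: by end_near. Qed.

HB.instance Definition _ := Lmodule_isNormed.Build R Lp normD normZ norm0_eq0.

Lemma Lspace_normE (u : Lp) : (`|u|%:E = 'N[mu]_p[EFin \o u])%E.
Proof. exact: (finite_norm_fine (Lfun_of u)). Qed.

Lemma Lspace_zero_ae : \forall t \ae mu, (0 : Lp) t = 0.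
Proof. exact: zeroE. Qed.

Lemma Lspace_opp_ae (u : Lp) :
  \forall t \ae mu, (- u : Lp) t = - u t.
Proof. exact: oppE. Qed.

Lemma Lspace_add_ae (u v : Lp) : \forall t \ae mu,
  (u + v : Lp) t = u t + v t.
Proof. exact: addE. Qed.

Lemma Lspace_scale_ae (a : R) (u : Lp) : \forall t \ae mu,
  (a *: u : Lp) t = a * u t.
Proof. exact: scaleE. Qed.

End Lspace_normed.

Section differentiability.
Context (R : realType) (V : normedModType R).

(* The derivative is continuous for the operator norm of the dual of V:
   the inner quantifier over v says that the norm of 'd F y - 'd F x is at
   most e. *)
Definition continuously_differentiable (F : V -> R) : Prop :=
  (forall x, differentiable F x) /\
  forall x (e : R), 0 < e ->
    \forall y \near x, forall v, `|'d F y v - 'd F x v| <= e * `|v|.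

Definition local_minimizer_on (f : V -> R) (C : set V) (x : V) : Prop :=
  C x /\ \forall y \near x, C y -> f x <= f y.

Definition tangent_cone (C : set V) (x : V) : set V :=
  [set v | exists (u : nat -> V) (t : nat -> R),
    [/\ (forall k, C (u k)) /\ u @ \oo --> x,
        forall k, 0 < t k,
        nonincreasing_seq t /\ t @ \oo --> 0 &
        (fun k => (t k)^-1 *: (u k - x)) @ \oo --> v]].

End differentiability.

Section Lspace_duality.
Context d (T : measurableType d) (R : realType).
Variables (mu : {measure set T -> \bar R}).
Variables (p q : \bar R) (p1 : (1 <= p)%E) (q1 : (1 <= q)%E).

Local Notation Lp := (LspaceType mu p1).
Local Notation Lq := (LspaceType mu q1).

Definition pairing (y : Lq) (x : Lp) : R :=
  \int[mu]_t (y t * x t).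

(* The functional l on L^p belongs to L^q, seen as a space of functionals
   through the pairing. *)
Definition in_Lspace_dual (l : Lp -> R) : Prop :=
  exists y : Lq, forall v, l v = pairing y v.

(* A subset of L^q, also when p = +oo and L^q = L^1 is only a predual. *)
Definition normal_cone (C : set Lp) (x : Lp) : set Lq :=
  [set y | forall v, tangent_cone C x v -> pairing y v <= 0].

Definition box (xa xb : T -> \bar R) : set Lp :=
  [set x | \forall t \ae mu, (xa t <= (x t)%:E <= xb t)%E].

Definition polyhedron n m (g : 'I_n -> Lq) (a : 'I_n -> R)
    (h : 'I_m -> Lq) (b : 'I_m -> R) : set Lp :=
  [set x | (forall i, pairing (g i) x <= a i) /\
           (forall j, pairing (h j) x = b j)].

Definition nonlinear_constraints N (G : 'I_N -> Lp -> R) : set Lp :=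
  [set x | forall i, G i x <= 0].

End Lspace_duality.

Arguments in_Lspace_dual {d T R mu p q p1} q1 l.
Arguments normal_cone {d T R mu p q p1} q1 C x.
Arguments box {d T R} mu {p} p1 xa xb.

(* Main.v *)
Require Import Defs.
From HB Require Import structures.
From mathcomp Require Import all_boot all_order all_algebra.
From mathcomp Require Import all_classical all_reals all_analysis.
From mathcomp Require Import measurable_realfun ess_sup_inf lra ring.

Set Implicit Arguments.
Unset Strict Implicit.
Unset Printing Implicit Defensive.

Import Order.TTheory GRing.Theory Num.Theory.
Import numFieldNormedType.Exports.

Local Open Scope classical_set_scope.
Local Open Scope ring_scope.

(** The constraints other than the order interval [K] are finitely many, and
    after linearization at [xbar] they are linear. A direction [v] with
    [xbar + v] in [K] that satisfies the linearized constraints, strictly for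
    the active nonlinear ones, is tangent to [E]
    ([linearized_direction_tangent]). The Slater point [xt] lets the strict
    inequalities be relaxed by a convex combination, so an element [y] of the
    normal cone of [E] is nonpositive on the part of the convex set [K - xbar]
    cut out by finitely many homogeneous linear inequalities and equalities.

    What remains is a Farkas lemma ([multipliers]) for a convex set that need
    not be closed and whose interior may be empty, as happens in L^p for
    [p < +oo]; a separation theorem in L^p is therefore of no help. The lemma
    is proved by eliminating one constraint at a time, each multiplier being a
    supremum of slopes. The induction only needs that no nonzero functional of
    L^q is nonpositive on [K - xbar] and nonnegative at [xt - xbar]. This
    holds because [xt] lies strictly between the bounds almost everywhere: it
    can be moved up and down by small bumps supported on sets of finite
    measure ([box_maximizer_sign], [box_inner]). The functional left after
    subtraction of the multipliers is nonpositive on [K - xbar]; it is the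
    component in the normal cone of [K], and the same bumps at [xbar] give its
    sign on the three regions.

    All functionals must be elements of L^q. When [p = +oo] this is assumed
    for the derivatives; when [p < +oo] it is the Riesz representation theorem
    ([Lspace_dual]). For a continuous functional [l], the set function that
    sends [A] to [l (w \1_A)], where [w] is a positive weight in L^p, is a
    finite signed measure; its Radon-Nikodym density divided by [w] represents
    [l] ([density_sgn]) and lies in L^q by testing against powers of itself, or
    against indicators when [p = 1].

    Finally, at a local minimizer the negative of the derivative of [f] is
    normal to [E], and the decomposition of this normal vector is the
    multiplier rule. *)

(** * Multipliers for a convex set and finitely many linear constraints *)

Section multipliers.
Context (R : realType) (V W : lmodType R) (phi : W -> V -> R).
Hypothesis phiDl : forall w w' v, phi (w + w') v = phi w v + phi w' v.
Hypothesis phiZl : forall a w v, phi (a *: w) v = a * phi w v.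
Hypothesis phiDr : forall w v v', phi w (v + v') = phi w v + phi w v'.
Hypothesis phiZr : forall a w v, phi w (a *: v) = a * phi w v.

Let phi0 v : phi 0 v = 0.
Proof. by rewrite -(scale0r 0) phiZl mul0r. Qed.

Let phiN w v : phi (- w) v = - phi w v.
Proof. by rewrite -scaleN1r phiZl mulN1r. Qed.

Let phiB w w' v : phi (w - w') v = phi w v - phi w' v.
Proof. by rewrite phiDl phiN. Qed.

Definition convex_subset (C : set V) := forall u v (s : R),
  C u -> C v -> 0 <= s -> s <= 1 -> C (s *: u + (1 - s) *: v).

(** The multiplier is the supremum of the slopes [phi y u / phi l u] over the
    part of [C] where [l] is positive; convexity says that these slopes lie
    below those over the part where [l] is negative, since the segment joining
    the two points crosses the hyperplane [l = 0] inside [C]. *)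
Lemma multiplier_eq1 (C : set V) (y l : W) : convex_subset C ->
  (forall v, C v -> phi l v = 0 -> phi y v <= 0) ->
  (exists2 v, C v & phi l v < 0) -> (exists2 v, C v & 0 < phi l v) ->
  exists c, forall v, C v -> phi (y - c *: l) v <= 0.
Proof.
move=> Cconv y0 [vn Cvn ln] [vp Cvp lp].
pose S := [set phi y u / phi l u | u in [set u | C u /\ 0 < phi l u]].
have slope u v : C u -> 0 < phi l u -> C v -> phi l v < 0 ->
    phi y u / phi l u <= phi y v / phi l v.
  move=> Cu lu Cv lv; set a := phi l u; set b := phi l v.
  have ab : 0 < a - b by rewrite subr_gt0 (lt_trans lv).
  have := @Cconv u v (- b / (a - b)) Cu Cv.
  rewrite divr_ge0; [|by rewrite oppr_ge0 ltW|exact: ltW].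
  rewrite ler_pdivrMr// mul1r lerDr [0 <= a]ltW// => /(_ isT isT).
  have -> : 1 - - b / (a - b) = a / (a - b).
    by rewrite -{1}(divff (lt0r_neq0 ab)) -mulrBl opprK subrK.
  move=> Cw; have := y0 _ Cw; rewrite !phiDr !phiZr => h.
  have /h : - b / (a - b) * phi l u + a / (a - b) * phi l v = 0.
    by rewrite -/a -/b; field; rewrite lt0r_neq0.
  rewrite !(mulrAC _ _^-1) -mulrDl pmulr_lle0 ?invr_gt0// => hy.
  rewrite ler_pdivrMr// mulrAC ler_ndivlMr// -/a -/b.
  by nra.
have S0 : S !=set0 by exists (phi y vp / phi l vp); exists vp.
have Sub v : C v -> phi l v < 0 -> ubound S (phi y v / phi l v).
  by move=> Cv lv _ [u [Cu lu] <-]; exact: slope.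
have hS : has_sup S by split => //; exists (phi y vn / phi l vn); exact: Sub.
exists (sup S) => v Cv; rewrite phiB phiZl subr_le0.
have [lv|lv|lv] := ltgtP (phi l v) 0.
- by rewrite -ler_ndivlMr//; apply: ge_sup => //; exact: Sub.
- by rewrite -ler_pdivrMr//; apply: ub_le_sup; [exact: hS.2|exists v].
- by rewrite lv mulr0 y0.
Qed.

Lemma multiplier_ineq1 (C : set V) (y l : W) : convex_subset C ->
  (forall v, C v -> phi l v <= 0 -> phi y v <= 0) ->
  (exists2 v, C v & phi l v < 0) ->
  exists2 c, 0 <= c & forall v, C v -> phi (y - c *: l) v <= 0.
Proof.
move=> Cconv y0 Cn.
have [lp|/forallNP lp] := pselect (exists v, C v /\ 0 < phi l v); last first.
  exists 0 => // v Cv; rewrite scale0r subr0 y0//.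
  by rewrite leNgt; apply/negP => lv; apply: (lp v).
have y00 v : C v -> phi l v = 0 -> phi y v <= 0.
  by move=> Cv lv; apply: y0 => //; rewrite lv.
have {}lp : exists2 v, C v & 0 < phi l v by case: lp => v [? ?]; exists v.
have [c hc] := multiplier_eq1 Cconv y00 Cn lp.
have [c0|c0] := leP 0 c; first by exists c.
(* if the slope is negative, [y] is already nonpositive on [C] *)
exists 0 => // v Cv; rewrite scale0r subr0.
have [lv|lv] := leP (phi l v) 0; first exact: y0.
by have := hc v Cv; rewrite phiB phiZl subr_le0 => /le_trans; apply; nra.
Qed.

Context (I : eqType) (l : I -> W) (C : set V) (d0 : V).
Hypothesis Cconv : convex_subset C.
Hypothesis Cd0 : C d0.
(* [d0] lies on no hyperplane through 0 that is given by [W] and bounds [C] *)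
Hypothesis d0_inner : forall w,
  (forall v, C v -> phi w v <= 0) -> 0 <= phi w d0 -> w = 0.

Definition feasible (s t : seq I) (v : V) :=
  (forall i, i \in s -> phi (l i) v <= 0) /\
  (forall j, j \in t -> phi (l j) v = 0).

Let feasible_convex s t : convex_subset [set v | C v /\ feasible s t v].
Proof.
move=> u v c [Cu [su tu]] [Cv [sv tv]] c0 c1; split; first exact: Cconv.
split => i it; rewrite phiDr !phiZr.
  by rewrite -(addr0 0) lerD// mulr_ge0_le0 ?su ?sv// subr_ge0.
by rewrite tu// tv// !mulr0 addr0.
Qed.

Let phi_sum (s : seq I) (c : I -> R) v :
  phi (\sum_(i <- s) c i *: l i) v = \sum_(i <- s) c i * phi (l i) v.
Proof.
elim: s => [|i s IH]; first by rewrite !big_nil phi0.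
by rewrite !big_cons phiDl phiZl IH.
Qed.

(** A functional in [l] vanishing at [d0] either takes both signs on the part
    of [C] where the previous ones vanish, or is a combination of these: in
    the second case its constraint is redundant. *)
Lemma multipliers_eq (t : seq I) (y : W) : uniq t -> feasible [::] t d0 ->
  (forall v, C v -> feasible [::] t v -> phi y v <= 0) ->
  exists b : I -> R,
    forall v, C v -> phi (y - \sum_(j <- t) b j *: l j) v <= 0.
Proof.
have one_sided k (t' : seq I) (IH : forall z,
      (forall v, C v -> feasible [::] t' v -> phi z v <= 0) ->
      exists b : I -> R,
      forall v, C v -> phi (z - \sum_(j <- t') b j *: l j) v <= 0) e :
    e != 0 -> feasible [::] (k :: t') d0 ->
    (forall v, C v -> feasible [::] t' v -> phi (e *: l k) v <= 0) ->
    forall v, feasible [::] t' v -> phi (l k) v = 0.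
  move=> e0 [_ td0] /IH[b hb] v [_ tv].
  have ek0 : e *: l k - \sum_(j <- t') b j *: l j = 0.
    apply: d0_inner => //; rewrite phiB phiZl phi_sum td0 ?mem_head// mulr0.
    by rewrite big_seq big1 ?subr0// => j jt; rewrite td0 ?inE ?jt ?orbT ?mulr0.
  have : phi (e *: l k) v = 0.
    rewrite (subr0_eq ek0) phi_sum big_seq big1// => j jt.
    by rewrite tv ?mulr0.
  by rewrite phiZl => /eqP; rewrite mulf_eq0 (negbTE e0)/= => /eqP.
elim: t y => [|k t IH] y.
  by move=> _ _ hy; exists (cst 0) => v Cv; rewrite big_nil subr0 hy.
move=> /andP[kt ut] ktd0 hy.
have td0' : feasible [::] t d0.
  by split => // j jt; apply: ktd0.2; rewrite inE jt orbT.
have IHt z := IH z ut td0'.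
have red : (forall v, feasible [::] t v -> phi (l k) v = 0) ->
    exists b : I -> R,
      forall v, C v -> phi (y - \sum_(j <- k :: t) b j *: l j) v <= 0.
  move=> lk; have [|b hb] := IHt y.
    move=> v Cv tv; apply: hy => //; split => // j; rewrite inE.
    by move=> /predU1P[->|]; [exact: lk|exact: tv.2].
  exists (fun j => if j == k then 0 else b j) => v Cv.
  rewrite big_cons eqxx scale0r add0r.
  rewrite (eq_big_seq (fun j => b j *: l j)) ?hb// => j jt.
  by case: eqP jt kt => // -> ->.
have [cp|/forallNP cp] := pselect (exists v, (C v /\ feasible [::] t v) /\ 0 < phi (l k) v);
  last first.
  apply: red; apply: (one_sided k t IHt 1 (oner_neq0 _) ktd0).
  move=> v Cv tv; rewrite scale1r leNgt; apply/negP => lv; exact: (cp v).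
have [cn|/forallNP cn] := pselect (exists v, (C v /\ feasible [::] t v) /\ phi (l k) v < 0);
  last first.
  have N1 : -1 != 0 :> R by rewrite oppr_eq0 oner_neq0.
  apply: red; apply: (one_sided k t IHt (-1) N1 ktd0).
  move=> v Cv tv; rewrite scaleN1r phiN oppr_le0 leNgt; apply/negP => lv; exact: (cn v).
have [| | |c hc] := @multiplier_eq1 [set v | C v /\ feasible [::] t v] y (l k)
  (@feasible_convex _ _).
- move=> v [Cv tv] lv; apply: hy => //; split => // j; rewrite inE.
  by move=> /predU1P[->//|]; exact: tv.2.
- by case: cn => v [? ?]; exists v.
- by case: cp => v [? ?]; exists v.
have [|b hb] := IHt (y - c *: l k); first by move=> v Cv tv; exact: hc.
exists (fun j => if j == k then c else b j) => v Cv.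
rewrite big_cons eqxx opprD addrA.
rewrite (eq_big_seq (fun j => b j *: l j)) ?hb// => j jt.
by case: eqP jt kt => // -> ->.
Qed.

(** Induction on the number of inequalities. If some feasible point satisfies
    [l k < 0], the constraint [l k <= 0] is absorbed by [multiplier_ineq1].
    Otherwise [- l k <= 0] follows from the other constraints, and the
    multipliers of that implication express [- l k] through them, because
    [d0] is inner; so [l k] may be treated as an equality, and a multiplier
    of the wrong sign is traded against that expression. *)
Lemma multipliers (s t : seq I) (y : W) : uniq (s ++ t) -> feasible s t d0 ->
  (forall v, C v -> feasible s t v -> phi y v <= 0) ->
  exists c b : I -> R, (forall i, 0 <= c i) /\
    forall v, C v ->
      phi (y - \sum_(i <- s) c i *: l i - \sum_(j <- t) b j *: l j) v <= 0.
Proof.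
elim: s t y => [|k s IH] t y.
  move=> ut fd0 /(multipliers_eq ut fd0)[b hb]; exists (cst 0), b; split => // v Cv.
  by rewrite big_nil subr0; exact: hb.
rewrite cat_cons => /andP[kst ust] [sd0 td0] hy.
have [ks kt] : k \notin s /\ k \notin t by move: kst; rewrite mem_cat negb_or => /andP.
have fd0 : feasible s t d0.
  by split => // i si; apply: sd0; rewrite inE si orbT.
have chk (x : R) (r : seq I) (c : I -> R) : k \notin r ->
    \sum_(i <- r) (if i == k then x else c i) *: l i = \sum_(i <- r) c i *: l i.
  by move=> kr; apply: eq_big_seq => j jr; case: eqP jr kr => // -> ->.
have [cn|/forallNP cn] := pselect (exists v, (C v /\ feasible s t v) /\ phi (l k) v < 0).
  have [| |e e0 he] := @multiplier_ineq1 [set v | C v /\ feasible s t v] y (l k)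
      (@feasible_convex _ _).
  - move=> v [Cv [sv tv]] lv; apply: hy => //; split => // i; rewrite inE.
    by move=> /predU1P[->//|]; exact: sv.
  - by case: cn => v [? ?]; exists v.
  have [|c [b [c0 hcb]]] := IH t (y - e *: l k) ust fd0; first by move=> v Cv fv; exact: he.
  exists (fun i => if i == k then e else c i), b; split.
    by move=> i; case: ifP.
  by move=> v Cv; rewrite big_cons eqxx chk// opprD addrA hcb.
have [|c [b [c0 hcb]]] := IH t (- l k) ust fd0.
  by move=> v Cv fv; rewrite phiN oppr_le0 leNgt; apply/negP => lv; exact: (cn v).
have lkE : - l k = \sum_(i <- s) c i *: l i + \sum_(j <- t) b j *: l j.
  apply/subr0_eq; rewrite opprD addrA; apply: d0_inner => //.
  rewrite !phiB !phi_sum phiN [X in _ - X]big_seq [X in _ - X]big1; last first.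
    by move=> j jt; rewrite td0 ?mulr0.
  rewrite subr0 subr_ge0 (@le_trans _ _ 0)//; last by rewrite oppr_ge0 sd0 ?mem_head.
  rewrite big_seq; apply: sumr_le0 => i si.
  by rewrite mulr_ge0_le0// fd0.1.
have uskt : uniq (s ++ k :: t) by rewrite -cat1s uniq_catCA /= kst.
have [| |c' [b' [c'0 hcb']]] := IH (k :: t) y uskt.
- split; first exact: fd0.1.
  move=> j; rewrite inE => /predU1P[->|]; last exact: td0.
  apply/eqP; rewrite eq_le sd0 ?mem_head//= leNgt; apply/negP => lv.
  exact: (cn d0).
- move=> v Cv [sv tv]; apply: hy => //; split => [i|j jt]; last first.
    by apply: tv; rewrite inE jt orbT.
  by rewrite inE => /predU1P[->|]; [rewrite tv ?mem_head|exact: sv].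
have [bk0|bk0] := leP 0 (b' k).
  exists (fun i => if i == k then b' k else c' i), b'; split.
    by move=> i; case: ifP.
  move=> v Cv; have := hcb' v Cv; congr (phi _ v <= 0).
  by rewrite !big_cons eqxx chk// !opprD !addrA (addrAC y).
exists (fun i => if i == k then 0 else c' i - b' k * c i), (fun j => b' j - b' k * b j).
split.
  by move=> i; case: ifP => // _; rewrite subr_ge0 (le_trans _ (c'0 i))// nmulr_rle0.
move=> v Cv; have := hcb' v Cv; congr (phi _ v <= 0).
rewrite !big_cons eqxx scale0r add0r chk//.
under [in RHS]eq_bigr do rewrite scalerBl -scalerA.
rewrite sumrB -scaler_sumr.
under [X in _ = _ - X]eq_bigr do rewrite scalerBl -scalerA.
rewrite sumrB -scaler_sumr.
have -> : b' k *: l k = - (b' k *: (\sum_(i <- s) c i *: l i + \sum_(j <- t) b j *: l j)).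
  by rewrite -lkE scalerN opprK.
by rewrite scalerDr !opprD !opprK !addrA [RHS]addrAC.
Qed.

End multipliers.

(** * Membership in L^p and the duality pairing *)

Lemma integral_le0_ae0 d (T : measurableType d) (R : realType)
    (mu : {measure set T -> \bar R}) (k : T -> R) :
  measurable_fun [set: T] k -> (forall t, 0 <= k t) ->
  (\int[mu]_t (k t)%:E <= 0)%E -> \forall t \ae mu, k t = 0.
Proof.
move=> mk k0 ik.
have ik0 : (\int[mu]_t `|(k t)%:E| = 0)%E.
  under eq_integral do rewrite gee0_abs ?lee_fin//.
  by apply/eqP; rewrite eq_le ik integral_ge0// => t _; rewrite lee_fin.
have /ae_eq_integral_abs : measurable_fun [set: T] (EFin \o k) by exact/measurable_EFinP.
move=> /(_ mu measurableT)[/(_ ik0) + _]; apply: filterS => t /(_ I).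
by move=> [].
Qed.

Section Lfun_order.
Context d (T : measurableType d) (R : realType) (mu : {measure set T -> \bar R}).

Lemma le_Lnorm (p : \bar R) (f g : T -> R) : (1 <= p)%E ->
  measurable_fun [set: T] f -> measurable_fun [set: T] g ->
  (\forall t \ae mu, `|f t| <= `|g t|) ->
  ('N[mu]_p[EFin \o f] <= 'N[mu]_p[EFin \o g])%E.
Proof.
move=> + mf mg fg; rewrite unlock /Lnorm; case: p => [r r1|_|//].
- have r0 : 0 < r by rewrite (lt_le_trans ltr01)// -lee_fin.
  have mpow (h : T -> R) : measurable_fun setT h ->
      measurable_fun setT (fun t => (`|(EFin \o h) t| `^ r)%E).
    move=> mh; apply: (measurableT_comp (measurable_poweR r)).
    by apply: measurableT_comp => //; exact/measurable_EFinP.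
  have ige0 (h : T -> R) : (0 <= \int[mu]_t `|(EFin \o h) t| `^ r)%E.
    by apply: integral_ge0 => t _; exact: poweR_ge0.
  apply: gt0_ler_poweR; rewrite ?invr_ge0 ?(ltW r0)// ?in_itv/= ?leey ?ige0//.
  apply: ae_ge0_le_integral => //; [exact: mpow|exact: mpow|].
  apply: filterS fg => t fgt _ /=; rewrite lee_fin.
  by apply: ge0_ler_powR; rewrite ?nnegrE ?(ltW r0).
- case: ifP => // _; apply: le_ess_sup.
  by apply: filterS fg => t fgt; rewrite /= lee_fin.
Qed.

Lemma Lfun_measurable (p : \bar R) (f : T -> R) :
  f \in Lfun mu p -> measurable_fun [set: T] f.
Proof. by move=> /andP[]; rewrite inE. Qed.

Lemma Lfun_finite_norm (p : \bar R) (f : T -> R) :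
  f \in Lfun mu p -> ('N[mu]_p[EFin \o f] < +oo)%E.
Proof. by move=> /andP[_]; rewrite inE. Qed.

Lemma LfunI (p : \bar R) (f : T -> R) : measurable_fun [set: T] f ->
  ('N[mu]_p[EFin \o f] < +oo)%E -> f \in Lfun mu p.
Proof. by move=> mf nf; apply/andP; split; rewrite inE. Qed.

Lemma Lfun_le (p : \bar R) (f g : T -> R) : (1 <= p)%E ->
  measurable_fun [set: T] f -> g \in Lfun mu p ->
  (\forall t \ae mu, `|f t| <= `|g t|) -> f \in Lfun mu p.
Proof.
move=> p1 mf gp fg; apply: LfunI => //.
apply: le_lt_trans (Lfun_finite_norm gp).
by apply: le_Lnorm => //; exact: Lfun_measurable gp.
Qed.

Lemma Lfun_indic (p : \bar R) (A : set T) : (1 <= p)%E -> measurable A ->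
  (mu A < +oo)%E -> (\1_A : T -> R) \in Lfun mu p.
Proof.
move=> p1 mA muA; apply: LfunI => //.
rewrite unlock /Lnorm; case: p p1 => [r r1|_|//].
- have r0 : r != 0 by rewrite gt_eqF// (lt_le_trans ltr01)// -lee_fin.
  apply: poweR_lty; rewrite (_ : integral _ _ _ = mu A)//.
  rewrite -[X in mu X]setIT -integral_indic//; apply: eq_integral => t _ /=.
  rewrite indicE; case: (t \in A); rewrite ?normr1 ?powR1//.
  by rewrite mulr0n normr0 powR0.
- case: ifP => // _; apply: (@le_lt_trans _ _ 1%E); last exact: ltry.
  apply/ess_supP; apply: aeW => t /=; rewrite lee_fin indicE.
  by case: (t \in A); rewrite ?mulr1n ?mulr0n ?normr1 ?normr0.
Qed.

Lemma ae_le_Lnormy (f : T -> R) : f \in Lfun mu +oo%E ->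
  \forall t \ae mu, (`|f t|%:E <= 'N[mu]_+oo[EFin \o f])%E.
Proof.
move=> /Lfun_finite_norm; rewrite unlock /Lnorm; case: ifPn => [_ _|+ _].
  exact: (ess_sup_ge mu (abse \o (EFin \o f))).
rewrite -leNgt => muT; exists setT; split => //.
by apply/eqP; rewrite eq_le muT measure_ge0.
Qed.

Lemma conjugate_exponents (p q : \bar R) : (1 <= p)%E -> (1 <= q)%E ->
  (p^-1 + q^-1 = 1)%E ->
  [\/ p = 1%E /\ q = +oo%E, p = +oo%E /\ q = 1%E |
   exists r s : R, [/\ p = r%:E, q = s%:E, 1 < r, 1 < s & r^-1 + s^-1 = 1]].
Proof.
move=> p1 q1 pq.
have p0 : p != 0%E by rewrite gt_eqF// (lt_le_trans _ p1).
have pNy : (-oo < p)%E by rewrite (lt_le_trans _ p1)// ltNyr.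
have := pq; move/(hoelder_conjugateP _ pNy p0).
case: p p1 pq p0 pNy => [r|_ _ _ _|//]; last first.
  by rewrite hoelder_conjugatey => ->; apply: Or32.
case: q q1 => [s|_ _ _ _ _|//]; last first.
  by move=> /esym/hoelder_conjugate_eqy ->; apply: Or31.
rewrite !lee_fin => s1 r1 + _ _ _; rewrite !inver.
have r0 : 0 < r by exact: lt_le_trans r1.
have s0 : 0 < s by exact: lt_le_trans s1.
rewrite !gt_eqF// => -[rs]; apply: Or33; exists r, s; split => //.
- have ? : 0 < s^-1 by rewrite invr_gt0.
  rewrite lt_neqAle r1 andbT; apply/eqP => rE.
  by move: rs; rewrite -rE invr1; lra.
- have ? : 0 < r^-1 by rewrite invr_gt0.
  rewrite lt_neqAle s1 andbT; apply/eqP => sE.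
  by move: rs; rewrite -sE invr1; lra.
Qed.

Lemma Lnorm1_mul_le (f g : T -> R) : f \in Lfun mu +oo%E -> g \in Lfun mu 1%E ->
  ('N[mu]_1[EFin \o (f \* g)%R] <= 'N[mu]_+oo[EFin \o f] * 'N[mu]_1[EFin \o g])%E.
Proof.
move=> fy g1.
have mf := Lfun_measurable fy; have mg := Lfun_measurable g1.
have [c c0 cE] : exists2 c : R, 0 <= c & ('N[mu]_+oo[EFin \o f] = c%:E)%E.
  have := Lfun_finite_norm fy; have := Lnorm_ge0 mu +oo%E (EFin \o f).
  by case: Lnorm => [c c0 _| |]//; exists c.
have fc := ae_le_Lnormy fy; rewrite cE in fc *.
rewrite !Lnorm1 -ge0_integralZl//; last first.
  by apply: measurableT_comp => //; exact/measurable_EFinP.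
apply: ae_ge0_le_integral => //.
- apply: measurableT_comp => //; apply/measurable_EFinP; exact: measurable_funM.
- by move=> t _; rewrite mule_ge0.
- apply: emeasurable_funM => //.
  by apply: measurableT_comp => //; exact/measurable_EFinP.
- apply: filterS fc => t ft _ /=; rewrite normrM EFinM.
  by rewrite lee_pmul// !lee_fin.
Qed.

Lemma hoelder_conjugates (p q : \bar R) (f g : T -> R) :
  (1 <= p)%E -> (1 <= q)%E -> (p^-1 + q^-1 = 1)%E ->
  f \in Lfun mu p -> g \in Lfun mu q ->
  ('N[mu]_1[EFin \o (f \* g)%R] <= 'N[mu]_p[EFin \o f] * 'N[mu]_q[EFin \o g])%E.
Proof.
move=> p1 q1 /(conjugate_exponents p1 q1)[[-> ->]|[-> ->]|].
- move=> fp gq; rewrite muleC (_ : (f \* g)%R = (g \* f)%R).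
    exact: Lnorm1_mul_le.
  by apply/funext => t /=; rewrite mulrC.
- exact: Lnorm1_mul_le.
- move=> [r [s [-> -> r1 s1 rs]]] fp gq.
  apply: hoelder; rewrite ?(lt_trans ltr01)//; first exact: Lfun_measurable fp.
  exact: Lfun_measurable gq.
Qed.

End Lfun_order.

(** The facts about classes, restated for their values in [R] rather than in
    the measurable copy of [R], the form in which [rewrite] meets them. *)
Section Lspace_values.
Context d (T : measurableType d) (R : realType) (mu : {measure set T -> \bar R}).
Context (p : \bar R) (p1 : (1 <= p)%E).

Local Notation Lp := (LspaceType mu p1).

Lemma Lval_eqP (u v : Lp) : u = v <-> \forall t \ae mu, u t = v t.
Proof. exact: Lspace_eqP. Qed.

Lemma Lval_zero : \forall t \ae mu, (0 : Lp) t = 0.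
Proof. exact: Lspace_zero_ae. Qed.

Lemma Lval_add (u v : Lp) : \forall t \ae mu, (u + v) t = u t + v t.
Proof. exact: Lspace_add_ae. Qed.

Lemma Lval_scale (a : R) (u : Lp) : \forall t \ae mu, (a *: u) t = a * u t.
Proof. exact: Lspace_scale_ae. Qed.

Lemma Lval_opp (u : Lp) : \forall t \ae mu, (- u) t = - u t.
Proof. exact: Lspace_opp_ae. Qed.

Lemma Lval_sub (u v : Lp) : \forall t \ae mu, (u - v) t = u t - v t.
Proof.
near=> t; rewrite (near (Lval_add u (- v)) t)//.
by rewrite (near (Lval_opp v) t).
Unshelve. all: by end_near. Qed.

Lemma Lval_measurable (u : Lp) : measurable_fun [set: T] (u : T -> R).
Proof. exact: measurable_Lspace. Qed.

Lemma Lval_Lfun (u : Lp) : (u : T -> R) \in Lfun mu p.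
Proof. exact: Lspace_Lfun. Qed.

Lemma Lval_norm (u : Lp) : (`|u|%:E = 'N[mu]_p[EFin \o u])%E.
Proof. exact: Lspace_normE. Qed.

End Lspace_values.

Section Lspace_class.
Context d (T : measurableType d) (R : realType) (mu : {measure set T -> \bar R}).
Context (p : \bar R) (p1 : (1 <= p)%E).

(** The class of a p-integrable function; total, so that classes of explicit
    functions can be written before their integrability is checked. *)
Definition Lclass (f : T -> R) : LspaceType mu p1 :=
  if pselect (f \in Lfun mu p) is left fp then Lspace_of (Lfun_Sub p1 fp) else 0.

Lemma LclassE (f : T -> R) : f \in Lfun mu p ->
  \forall t \ae mu, Lclass f t = f t.
Proof.
by rewrite /Lclass; case: pselect => // fp _; exact: (Lspace_ofE (Lfun_Sub p1 fp)).
Qed.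

Lemma Lclass_eq (f : T -> R) (u : LspaceType mu p1) :
  f \in Lfun mu p -> (\forall t \ae mu, f t = u t) -> Lclass f = u.
Proof.
move=> fp fu; apply/Lval_eqP; near=> t.
by rewrite (near (LclassE fp) t)// (near fu t).
Unshelve. all: by end_near. Qed.

End Lspace_class.
Arguments Lclass {d T R} mu {p} p1 f.

Section pairing_theory.
Context d (T : measurableType d) (R : realType) (mu : {measure set T -> \bar R}).
Context (p q : \bar R) (p1 : (1 <= p)%E) (q1 : (1 <= q)%E).
Hypothesis pq : (p^-1 + q^-1 = 1)%E.

Local Notation Lp := (LspaceType mu p1).
Local Notation Lq := (LspaceType mu q1).

Lemma pairing_measurable (y : Lq) (x : Lp) :
  measurable_fun [set: T] (fun t => y t * x t).
Proof. by apply: measurable_funM; exact: Lval_measurable. Qed.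

Lemma pairing_Lnorm1 (y : Lq) (x : Lp) :
  (\int[mu]_t `|(y t * x t)%:E| <= (`|y| * `|x|)%:E)%E.
Proof.
rewrite EFinM !Lval_norm -(Lnorm1 mu (fun t => (y t * x t)%:E)).
apply: (hoelder_conjugates q1 p1); rewrite 1?addeC//; exact: Lval_Lfun.
Qed.

Lemma pairing_integrable (y : Lq) (x : Lp) :
  mu.-integrable [set: T] (fun t => (y t * x t)%:E).
Proof.
apply/integrableP; split; first exact/measurable_EFinP/pairing_measurable.
exact: le_lt_trans (pairing_Lnorm1 y x) (ltry _).
Qed.

Lemma pairing_ae (y : Lq) (x : Lp) (k : T -> R) : measurable_fun [set: T] k ->
  (\forall t \ae mu, y t * x t = k t) -> pairing y x = \int[mu]_t k t.
Proof.
move=> mk yxk; congr fine; apply: ae_eq_integral => //.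
- exact/measurable_EFinP/pairing_measurable.
- exact/measurable_EFinP.
- by apply: filterS yxk => t -> _.
Qed.

Lemma le_pairing (y : Lq) (x : Lp) : `|pairing y x| <= `|y| * `|x|.
Proof.
rewrite -lee_fin; apply: le_trans (pairing_Lnorm1 y x).
rewrite EFin_normr_Rintegral//; last exact: pairing_integrable.
apply: le_abse_integral => //.
exact/measurable_EFinP/pairing_measurable.
Qed.

Lemma pairingDl (y z : Lq) (x : Lp) : pairing (y + z) x = pairing y x + pairing z x.
Proof.
rewrite /pairing -RintegralD//; try exact: pairing_integrable.
apply: pairing_ae.
  by apply: measurable_funD; exact: pairing_measurable.
by apply: filterS (Lval_add y z) => t ->; rewrite mulrDl.
Qed.

Lemma pairingZl a (y : Lq) (x : Lp) : pairing (a *: y) x = a * pairing y x.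
Proof.
rewrite /pairing -RintegralZl//; try exact: pairing_integrable.
apply: pairing_ae.
  by apply: measurable_funM => //; exact: pairing_measurable.
by apply: filterS (Lval_scale a y) => t ->; rewrite mulrA.
Qed.

Lemma pairingDr (y : Lq) (x z : Lp) : pairing y (x + z) = pairing y x + pairing y z.
Proof.
rewrite /pairing -RintegralD//; try exact: pairing_integrable.
apply: pairing_ae.
  by apply: measurable_funD; exact: pairing_measurable.
by apply: filterS (Lval_add x z) => t ->; rewrite mulrDr.
Qed.

Lemma pairingZr a (y : Lq) (x : Lp) : pairing y (a *: x) = a * pairing y x.
Proof.
rewrite /pairing -RintegralZl//; try exact: pairing_integrable.
apply: pairing_ae.
  by apply: measurable_funM => //; exact: pairing_measurable.
by apply: filterS (Lval_scale a x) => t ->; rewrite mulrCA.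
Qed.

Lemma pairingNl (y : Lq) (x : Lp) : pairing (- y) x = - pairing y x.
Proof. by rewrite -scaleN1r pairingZl mulN1r. Qed.

Lemma pairingBr (y : Lq) (x z : Lp) : pairing y (x - z) = pairing y x - pairing y z.
Proof. by rewrite pairingDr -scaleN1r pairingZr mulN1r. Qed.

Lemma pairing0l (x : Lp) : pairing (0 : Lq) x = 0.
Proof. by rewrite -(scale0r (0 : Lq)) pairingZl mul0r. Qed.

Lemma pairing_suml (I : Type) (r : seq I) (P : pred I) (F : I -> Lq) (x : Lp) :
  pairing (\sum_(i <- r | P i) F i) x = \sum_(i <- r | P i) pairing (F i) x.
Proof.
by apply: (big_morph (fun y : Lq => pairing y x)) => [y z|]; rewrite ?pairingDl ?pairing0l.
Qed.

Lemma pairing_cvg (y : Lq) (u : nat -> Lp) (v : Lp) :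
  u @ \oo --> v -> (fun k => pairing y (u k)) @ \oo --> pairing y v.
Proof.
move=> uv; apply/cvgrPdist_le => e e0.
have e1 : 0 < e / (`|y| + 1) by rewrite divr_gt0// ltr_wpDl.
move/cvgrPdist_le: uv => /(_ _ e1); apply: filterS => k uk.
rewrite -pairingBr (le_trans (le_pairing _ _))//.
rewrite (le_trans (ler_wpM2l _ uk))// mulrCA ler_piMr ?(ltW e0)//.
by rewrite ler_pdivrMr ?ltr_wpDl// mul1r lerDl.
Qed.

End pairing_theory.

(** * Tangent cones *)

Section tangent_cones.
Context (R : realType) (V : normedModType R).
Implicit Types (C D : set V) (x v : V).

Lemma tangent_coneS C D x : C `<=` D -> tangent_cone C x `<=` tangent_cone D x.
Proof.
by move=> CD v [u [t [[Cu ux] t0 tt uv]]]; exists u, t; split => //; split => // k; exact: CD.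
Qed.

Lemma cvg_shrink x v (e : R) : (fun k => x + (e * k.+1%:R^-1) *: v) @ \oo --> x.
Proof.
rewrite -[X in _ --> X]addr0; apply: cvgD; first exact: cvg_cst.
rewrite -(scale0r v); apply: cvgZr_tmp.
by rewrite -(mulr0 e); apply: cvgMl_tmp; exact: cvg_harmonic.
Qed.

Lemma feasible_direction_tangent C x v :
  (\forall s \near 0^'+, C (x + s *: v)) -> tangent_cone C x v.
Proof.
move=> [e /= e0 he]; pose t k := (e / 2) * k.+1%:R^-1.
have e20 : 0 < e / 2 by rewrite divr_gt0.
have t0 k : 0 < t k by rewrite mulr_gt0// invr_gt0.
exists (fun k => x + t k *: v), t; split => //.
- split; last exact: cvg_shrink.
  move=> k; apply: he => //=; rewrite sub0r normrN gtr0_norm//.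
  rewrite (@le_lt_trans _ _ (e / 2))//; last by rewrite ltr_pdivrMr// ltr_pMr// ltr1n.
  by rewrite /t ler_piMr ?(ltW e20)// invf_le1// ler1n.
- split; first by apply/nonincreasing_seqP => k; rewrite ler_pM2l// lef_pV2 ?posrE// ler_nat.
  by rewrite -(mulr0 (e / 2)); apply: cvgMl_tmp; exact: cvg_harmonic.
- rewrite [X in X @ _ --> _](_ : _ = cst v); first exact: cvg_cst.
  apply/funext => k; rewrite addrAC subrr add0r scalerA mulVf ?scale1r//.
  by rewrite gt_eqF.
Qed.

Lemma diff_expansion (F : V -> R) x (e : R) : differentiable F x -> 0 < e ->
  \forall y \near x, `|F y - F x - 'd F x (y - x)| <= e * `|y - x|.
Proof.
move=> dF e0.
have /eqaddoP/(_ _ e0) := diff_locally dF.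
move=> h; have : \forall y \near x,
    `|((F \o shift x) - (cst (F x) + 'd F x : V -> R)) (y - x)| <= e * `|y - x|.
  by rewrite (near_shift 0 x)/= ; apply: filterS h => y /=; rewrite subr0 addrK.
by apply: filterS => y; rewrite /= !fctE /= subrK opprD addrA.
Qed.

(** The difference quotients along a tangent sequence, which approaches [x]
    from varying directions, still converge to the derivative because the
    expansion of [F] is uniform in the direction. *)
Lemma diff_quotient_cvg (F : V -> R) x (u : nat -> V) (t : nat -> R) v :
  differentiable F x -> u @ \oo --> x -> (forall k, 0 < t k) ->
  (fun k => (t k)^-1 *: (u k - x)) @ \oo --> v ->
  (fun k => (t k)^-1 * (F (u k) - F x)) @ \oo --> 'd F x v.
Proof.
move=> dF ux t0 uv; pose w k := (t k)^-1 *: (u k - x).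
have dw : (fun k => 'd F x (w k)) @ \oo --> 'd F x v.
  by apply: (continuous_cvg _ _ uv); exact: diff_continuous.
have : (fun k => (t k)^-1 * (F (u k) - F x) - 'd F x (w k)) @ \oo --> 0.
  apply/cvgr0Pnorm_le => e e0.
  have v1 : 0 < `|v| + 1 by rewrite ltr_wpDl.
  have ev : 0 < e / (`|v| + 1) by rewrite divr_gt0.
  have wv : \forall k \near \oo, `|w k| <= `|v| + 1.
    move/cvgrPdist_le: uv => /(_ _ ltr01); apply: filterS => k vw.
    by rewrite -(subrK v (w k)) addrC (le_trans (ler_normD _ _))// lerD2l distrC.
  have uF : \forall k \near \oo, `|F (u k) - F x - 'd F x (u k - x)| <=
      e / (`|v| + 1) * `|u k - x| := ux _ (diff_expansion dF ev).
  near=> k.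
  rewrite /w linearZ/= -mulrBr normrM gtr0_norm ?invr_gt0//.
  have /= h := near uF k; rewrite (@le_trans _ _ ((t k)^-1 * (e / (`|v| + 1) * `|u k - x|)))//.
    by rewrite ler_wpM2l ?invr_ge0 ?(ltW (t0 k))// h.
  rewrite mulrCA -[X in _ * (X * _)]gtr0_norm ?invr_gt0// -normrZ -/(w k).
  rewrite -mulrA ler_piMr ?(ltW e0)// ler_pdivrMl// mulr1.
  exact: (near wv k).
move=> /cvgD /(_ dw); rewrite add0r; apply: cvg_trans; apply: near_eq_cvg.
by apply: nearW => k; rewrite /= subrK.
Unshelve. all: by end_near. Qed.

Lemma tangent_cone_diff_le (F : V -> R) C x v : differentiable F x ->
  (\forall y \near x, C y -> F y <= F x) -> tangent_cone C x v -> 'd F x v <= 0.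
Proof.
move=> dF CF [u [t [[Cu ux] t0 _ uv]]].
have := diff_quotient_cvg dF ux t0 uv => /cvgr_to_le; apply.
have CFu : \forall k \near \oo, C (u k) -> F (u k) <= F x := ux _ CF.
apply: filterS CFu => k /(_ (Cu k)) uk.
by rewrite mulr_ge0_le0 ?invr_ge0 ?(ltW (t0 k))// subr_le0.
Qed.

Lemma line_cvg_right x v : (x + s *: v) @[s --> 0^'+] --> x.
Proof.
rewrite -[X in _ --> X]addr0; apply: cvgD; first exact: cvg_cst.
by rewrite -(scale0r v); apply: cvgZr_tmp; apply: cvg_at_right_filter; exact: cvg_id.
Qed.

Lemma diff_lt0_decrease (F : V -> R) x v : differentiable F x -> 'd F x v < 0 ->
  \forall s \near 0^'+, F (x + s *: v) < F x.
Proof.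
move=> dF dv; have v1 : 0 < `|v| + 1 by rewrite ltr_wpDl.
have e0 : 0 < - 'd F x v / (`|v| + 1) by rewrite divr_gt0// oppr_gt0.
have h : \forall s \near 0^'+, `|F (x + s *: v) - F x - 'd F x (x + s *: v - x)| <=
    - 'd F x v / (`|v| + 1) * `|x + s *: v - x| := line_cvg_right v (diff_expansion dF e0).
near=> s; have s0 : 0 < s by near: s; exact: nbhs_right_gt.
have hs : `|F (x + s *: v) - F x - 'd F x (x + s *: v - x)| <=
    - 'd F x v / (`|v| + 1) * `|x + s *: v - x| by near: s; exact: h.
move: hs; have -> : x + s *: v - x = s *: v by rewrite addrAC subrr add0r.
rewrite linearZ/= [X in _ * X]normrZ gtr0_norm//.
move=> /(le_trans (ler_norm _)); rewrite lerBlDr -subr_lt0 => /le_lt_trans; apply.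
rewrite mulrCA -[X in _ + X]/(s * 'd F x v) -mulrDr pmulr_rlt0// -ltrBrDr sub0r.
by rewrite mulrAC ltr_pdivrMr// ltr_pM2l ?oppr_gt0// ltrDl.
Unshelve. all: by end_near. Qed.

End tangent_cones.

(** * Order intervals of L^p *)

Section boxes.
Context d (T : measurableType d) (R : realType).
Context (mu : {sigma_finite_measure set T -> \bar R}).
Context (p q : \bar R) (p1 : (1 <= p)%E) (q1 : (1 <= q)%E).
Hypothesis pq : (p^-1 + q^-1 = 1)%E.
Context (xa xb : T -> \bar R).
Hypothesis mxa : measurable_fun [set: T] xa.
Hypothesis mxb : measurable_fun [set: T] xb.

Local Notation Lp := (LspaceType mu p1).
Local Notation Lq := (LspaceType mu q1).

Lemma tangent_cone_pairing_le (C : set Lp) (y : Lq) (x v : Lp) :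
  (forall z, C z -> pairing y z <= pairing y x) ->
  tangent_cone C x v -> pairing y v <= 0.
Proof.
move=> Cy [u [t [[Cu ux] t0 _ uv]]].
have /cvgr_to_le := pairing_cvg pq (y := y) uv; apply.
apply: nearW => k; rewrite pairingZr// pairingBr//.
by rewrite mulr_ge0_le0 ?invr_ge0 ?(ltW (t0 k))// subr_le0 Cy.
Qed.

Let boxP (x : Lp) :
  box mu p1 xa xb x <-> \forall t \ae mu, (xa t <= (x t)%:E <= xb t)%E.
Proof. by []. Qed.

Lemma box_convex : convex_subset (box mu p1 xa xb).
Proof.
move=> u v s /boxP Ku /boxP Kv s0 s1; apply/boxP; near=> t.
have -> : (s *: u + (1 - s) *: v) t = s * u t + (1 - s) * v t.
  rewrite (near (Lval_add (s *: u) ((1 - s) *: v)) t)//.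
  by rewrite (near (Lval_scale s u) t)// (near (Lval_scale (1 - s) v) t).
have /andP[au ub] : (xa t <= (u t)%:E <= xb t)%E by near: t; exact: Ku.
have /andP[av vb] : (xa t <= (v t)%:E <= xb t)%E by near: t; exact: Kv.
apply/andP; split.
- move: au av; clear ub vb; case: (xa t) => [r| |]//; last by move=> _ _; rewrite leNye.
  by rewrite !lee_fin; nra.
- move: ub vb; clear au av; case: (xb t) => [r| |]//; last by move=> _ _; rewrite leey.
  by rewrite !lee_fin; nra.
Unshelve. all: by end_near. Qed.

(** The bump [c \1_S] is an admissible variation of [z], so its pairing with
    [zeta] is nonpositive although the integrand is positive on [S]. *)
Lemma box_bump_null (z : Lp) (zeta : Lq) (c : R) (S : set T) :
  box mu p1 xa xb z ->
  (forall x, box mu p1 xa xb x -> pairing zeta x <= pairing zeta z) ->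
  measurable S -> (mu S < +oo)%E ->
  (\forall t \ae mu, S t -> (xa t <= (z t + c)%:E <= xb t)%E) ->
  (forall t, S t -> 0 < c * zeta t) ->
  \forall t \ae mu, ~ S t.
Proof.
move=> /boxP Kz zmax mS muS Sc Spos.
have iS : (\1_S : T -> R) \in Lfun mu p by exact: Lfun_indic.
pose w : Lp := c *: Lclass mu p1 \1_S.
have wE : \forall t \ae mu, w t = c * \1_S t.
  near=> t; rewrite (near (Lval_scale c (Lclass mu p1 \1_S)) t)//.
  by rewrite (near (LclassE p1 iS) t).
have Kzw : box mu p1 xa xb (z + w).
  apply/boxP; near=> t.
  have -> : (z + w) t = z t + c * \1_S t.
    by rewrite (near (Lval_add z w) t)// (near wE t).
  rewrite indicE; have [tS|tS] := boolP (t \in S).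
    by rewrite mulr1; rewrite inE in tS; move: tS; near: t; exact: Sc.
  by rewrite mulr0 addr0; near: t; exact: Kz.
have := zmax _ Kzw; rewrite pairingDr// gerDl => zw.
pose k t := c * zeta t * \1_S t.
have mk : measurable_fun [set: T] k.
  apply: measurable_funM => //; apply: measurable_funM => //.
  exact: Lval_measurable.
have k0 t : 0 <= k t.
  rewrite /k indicE; have [/set_mem tS|] := boolP (t \in S); last by rewrite mulr0.
  by rewrite mulr1 ltW// Spos.
have kE : \forall t \ae mu, zeta t * w t = k t.
  by apply: filterS wE => t ->; rewrite /k mulrCA mulrA.
have ik : (\int[mu]_t (k t)%:E = \int[mu]_t (zeta t * w t)%:E)%E.
  apply: ae_eq_integral => //; first exact/measurable_EFinP.
    exact/measurable_EFinP/pairing_measurable.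
  by apply: filterS kE => t kt _; rewrite -kt.
have ik0 : (\int[mu]_t (k t)%:E <= 0)%E.
  rewrite ik -[X in (X <= _)%E]fineK ?lee_fin//.
  exact: (integrable_fin_num measurableT (pairing_integrable pq zeta w)).
apply: filterS (integral_le0_ae0 mk k0 ik0) => t kt St.
by have := Spos t St; move: kt; rewrite /k indicE mem_set// mulr1 => ->; rewrite ltxx.
Unshelve. all: by end_near. Qed.

(** Where [z] lies below the upper bound there is room for a positive bump,
    which forbids [zeta > 0]; the room is quantified by [1 / (k + 1)] and
    localized on sets of finite measure, so that the bump lies in L^p. *)
Lemma box_maximizer_sign (z : Lp) (zeta : Lq) : box mu p1 xa xb z ->
  (forall x, box mu p1 xa xb x -> pairing zeta x <= pairing zeta z) ->
  \forall t \ae mu, (((z t)%:E < xb t)%E -> zeta t <= 0) /\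
                    ((xa t < (z t)%:E)%E -> 0 <= zeta t).
Proof.
move=> Kz zmax; have [F TF /all_and2[mF muF]] := sigma_finiteT mu.
have mz := Lval_measurable z; have mzeta := Lval_measurable zeta.
have mzc (c : R) : measurable_fun [set: T] (fun t => (z t + c)%:E).
  by apply/measurable_EFinP; exact: measurable_funD.
have mzetaE : measurable_fun [set: T] (EFin \o zeta) by exact/measurable_EFinP.
have mpos : measurable [set t | 0 < zeta t].
  by have := measurable_lte measurableT (measurable_cst 0%E) mzetaE; rewrite setTI.
have mneg : measurable [set t | zeta t < 0].
  by have := measurable_lte measurableT mzetaE (measurable_cst 0%E); rewrite setTI.
have mle (u v : T -> \bar R) : measurable_fun [set: T] u ->
    measurable_fun [set: T] v -> measurable [set t | (u t <= v t)%E].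
  by move=> mu_ mv; have := measurable_lee measurableT mu_ mv; rewrite setTI.
pose Su i k := F i `&` ([set t | 0 < zeta t] `&`
  [set t | ((z t + k.+1%:R^-1)%:E <= xb t)%E]).
pose Sl i k := F i `&` ([set t | zeta t < 0] `&`
  [set t | (xa t <= (z t - k.+1%:R^-1)%:E)%E]).
have null S i : measurable S -> S `<=` F i -> (mu S < +oo)%E.
  by move=> mS SF; apply: le_lt_trans (muF i); apply: le_measure; rewrite ?inE.
have Su0 : \forall t \ae mu, forall i k, ~ Su i k t.
  apply: ae_foralln => i; apply: ae_foralln => k.
  have mS : measurable (Su i k).
    by apply: measurableI => //; apply: measurableI => //; exact: mle.
  apply: (@box_bump_null z zeta k.+1%:R^-1 _ Kz zmax mS).
  + by apply: (null _ i) => // t [].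
  + by apply: filterS Kz => t /andP[az zb] [_ [_ ->]]; rewrite andbT (le_trans az)// lee_fin lerDl.
  + by move=> t [_ [zt _]]; rewrite mulr_gt0// invr_gt0.
have Sl0 : \forall t \ae mu, forall i k, ~ Sl i k t.
  apply: ae_foralln => i; apply: ae_foralln => k.
  have mS : measurable (Sl i k).
    by apply: measurableI => //; apply: measurableI => //; exact: mle.
  apply: (@box_bump_null z zeta (- k.+1%:R^-1) _ Kz zmax mS).
  + by apply: (null _ i) => // t [].
  + apply: filterS Kz => t /andP[az zb] [_ [_ ->]]/=.
    by rewrite (le_trans _ zb)// lee_fin gerBl.
  + by move=> t [_ [zt _]]; rewrite nmulr_rgt0// oppr_lt0 invr_gt0.
near=> t.
have Sut : forall i k, ~ Su i k t by near: t; exact: Su0.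
have Slt : forall i k, ~ Sl i k t by near: t; exact: Sl0.
have [i _ Fit] : (\bigcup_i F i) t by rewrite -TF.
split => [zb|az]; rewrite leNgt; apply/negP => zt.
- have [k hk] : exists k, ((z t + k.+1%:R^-1)%:E <= xb t)%E.
    move: zb; case: (xb t) => [r| |]//; last by exists 0%N; rewrite leey.
    rewrite lte_fin => /ltr_add_invr[k hk]; exists k.
    by rewrite lee_fin ltW.
  by apply: (Sut i k); split.
- have [k hk] : exists k, (xa t <= (z t - k.+1%:R^-1)%:E)%E.
    move: az; case: (xa t) => [r| |]//; last by exists 0%N; rewrite leNye.
    rewrite lte_fin => /ltr_add_invr[k hk]; exists k.
    by rewrite lee_fin lerBrDr ltW.
  by apply: (Slt i k); split.
Unshelve. all: by end_near. Qed.

(** A strictly interior point in the pointwise sense, which for [p < +oo] need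
    not be interior in norm, can still be moved both ways on any set, so it
    maximizes no nonzero element of L^q. *)
Lemma box_inner (xt : Lp) (zeta : Lq) :
  (\forall t \ae mu, (xa t < (xt t)%:E < xb t)%E) ->
  (forall x, box mu p1 xa xb x -> pairing zeta x <= pairing zeta xt) ->
  zeta = 0.
Proof.
move=> axb zmax.
have Kxt : box mu p1 xa xb xt.
  by apply: filterS axb => t /andP[/ltW-> /ltW->].
have sgn := box_maximizer_sign Kxt zmax.
apply/Lval_eqP; near=> t; rewrite (near (Lval_zero mu q1) t)//.
have /andP[at_ tb] : (xa t < (xt t)%:E < xb t)%E by near: t; exact: axb.
have [/(_ tb) z0 /(_ at_) z1] : (((xt t)%:E < xb t)%E -> zeta t <= 0) /\
  ((xa t < (xt t)%:E)%E -> 0 <= zeta t) by near: t; exact: sgn.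
by apply/eqP; rewrite eq_le z0.
Unshelve. all: by end_near. Qed.

End boxes.

(** * Representation of the dual of L^p, p < +oo *)

Section weight.
Context d (T : measurableType d) (R : realType).
Context (mu : {sigma_finite_measure set T -> \bar R}) (r : R).
Hypothesis r1 : 1 <= r.

(** With [F_n] a cover of finite measure, the [r]-th power of the weight is
    the sum of [2^-(n+1) / (1 + mu F_n)] over the [n] with [t] in [F_n]. *)
Lemma positive_Lfun_exists : exists w : T -> R,
  (forall t, 0 < w t) /\ w \in Lfun mu r%:E.
Proof.
have r0 : 0 < r by exact: lt_le_trans r1.
have [F TF /all_and2[mF muF]] := sigma_finiteT mu.
pose m n := fine (mu (F n)).
have m0 n : 0 <= m n by exact: fine_ge0.
have mE n : (m n)%:E = mu (F n) by rewrite fineK// ge0_fin_numE ?muF.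
pose a n : R := (1 / (2 ^ n.+1)%:R) / (1 + m n).
have p2 n : 0 < (2 ^ n.+1)%:R :> R by rewrite ltr0n expn_gt0.
have m1 n : 0 < 1 + m n by rewrite ltr_pwDl.
have a0 n : 0 < a n by rewrite !divr_gt0.
pose g n t : \bar R := (a n * \1_(F n) t)%:E.
have g0 n t : (0 <= g n t)%E by rewrite lee_fin mulr_ge0// ltW.
have mg n : measurable_fun [set: T] (g n).
  by apply/measurable_EFinP; apply: measurable_funM => //; exact: measurable_indic.
pose h t := (\sum_(n <oo) g n t)%E.
have mh : measurable_fun [set: T] h by exact: ge0_emeasurable_sum.
have h1 t : (h t <= 1)%E.
  apply: le_trans (epsilon_trick0 xpredT (@ler01 R)); apply: lee_nneseries => // n _.
  rewrite lee_fin /a indicE; case: (t \in F n); rewrite ?mulr1 ?mulr0 ?divr_ge0//.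
  by rewrite ler_pdivrMr// ler_peMr ?divr_ge0// lerDl.
have ih : (\int[mu]_t h t <= 1)%E.
  rewrite integral_nneseries//; apply: le_trans (epsilon_trick0 xpredT (@ler01 R)).
  apply: lee_nneseries => // [n _ _|n _]; first exact: integral_ge0.
  under eq_integral do rewrite /g EFinM.
  rewrite ge0_integralZl_EFin//; [|exact/measurable_EFinP/measurable_indic|exact: ltW].
  rewrite (_ : (\int[mu]_t _)%E = (m n)%:E); last by rewrite integral_indic// setIT mE.
  rewrite -EFinM lee_fin /a -(mulrA _ (1 + m n)^-1) ler_piMr ?divr_ge0//.
  by rewrite mulrC ler_pdivrMr// mul1r lerDr.
have h0 t : (0 < h t)%E.
  have [n _ Fnt] : (\bigcup_i F i) t by rewrite -TF.
  apply: (@lt_le_trans _ _ (g n t)).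
    by rewrite lte_fin indicE mem_set// mulr1.
  apply: le_trans (@nneseries_lim_ge _ (g ^~ t) xpredT 0 n.+1 _) => //.
  by rewrite big_nat_recr//= leeDr// sume_ge0.
have hfin t : h t \is a fin_num.
  by rewrite ge0_fin_numE ?(ltW (h0 t))// (le_lt_trans (h1 t))// ltry.
exists (fun t => fine (h t) `^ r^-1); split => [t|].
  by rewrite powR_gt0// fine_gt0// h0/= (le_lt_trans (h1 t))// ltry.
apply: LfunI.
  apply: (measurableT_comp (measurable_powR _)).
  exact: measurableT_comp.
rewrite unlock /Lnorm; apply: poweR_lty; apply: le_lt_trans (ltry 1).
apply: le_trans ih; rewrite le_eqVlt; apply/orP; left; apply/eqP.
apply: eq_integral => t _ /=.
rewrite ger0_norm ?powR_ge0// -powRrM mulVf ?gt_eqF// powRr1 ?fineK//.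
by rewrite fine_ge0// ltW.
Qed.

End weight.

Section Lspace_dominated_convergence.
Context d (T : measurableType d) (R : realType).
Context (mu : {measure set T -> \bar R}) (r : R) (p1 : (1 <= r%:E)%E).

Local Notation Lp := (LspaceType mu p1).

Let r0 : 0 < r.
Proof. by rewrite (lt_le_trans ltr01)// -lee_fin. Qed.

Lemma Lspace_norm_powR (x : Lp) :
  ((`|x| `^ r)%:E = \int[mu]_t (`|x t| `^ r)%:E)%E.
Proof. by rewrite -poweR_EFin Lval_norm poweR_Lnorm// gt_eqF. Qed.

Lemma measurable_norm_powR (f : T -> R) : measurable_fun [set: T] f ->
  measurable_fun [set: T] (fun t => (`|f t| `^ r)%:E).
Proof.
move=> mf; apply/measurable_EFinP; apply: (measurableT_comp (measurable_powR r)).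
exact: measurableT_comp.
Qed.

(** Dominated convergence for [|u n - v|^r], which is below [2^r |g|^r]. *)
Lemma Lspace_dominated_cvg (u : nat -> Lp) (v : Lp) (g : T -> R) :
  g \in Lfun mu r%:E ->
  (\forall t \ae mu, (fun n => u n t) @ \oo --> v t) ->
  (forall n, \forall t \ae mu, `|u n t| <= `|g t|) ->
  u @ \oo --> v.
Proof.
move=> gp uv ug; have mg := Lfun_measurable gp.
have subE : \forall t \ae mu, forall n, (u n - v) t = u n t - v t.
  by apply: ae_foralln => n; exact: Lval_sub.
have {}ug : \forall t \ae mu, forall n, `|u n t| <= `|g t| by exact: ae_foralln.
have vg : \forall t \ae mu, `|v t| <= `|g t|.
  near=> t; have uvt : (fun n => u n t) @ \oo --> v t by near: t; exact: uv.
  have ugt : forall n, `|u n t| <= `|g t| by near: t; exact: ug.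
  by apply: (cvgr_to_le (cvg_norm uvt)); apply: nearW.
pose f_ n t := (`|(u n - v) t| `^ r)%:E.
have f_cvg : \forall t \ae mu, [set: T] t -> f_ ^~ t @ \oo --> 0%:E.
  near=> t => _; have uvt : (fun n => u n t) @ \oo --> v t by near: t; exact: uv.
  have Et : forall n, (u n - v) t = u n t - v t by near: t; exact: subE.
  apply: cvg_EFin; first exact: nearW.
  rewrite (_ : fine \o _ = fun n => `|u n t - v t| `^ r); last first.
    by apply/funext => n /=; rewrite Et.
  apply/cvgrPdist_lt => e e0; have er : 0 < e `^ r^-1 by rewrite powR_gt0.
  move/cvgrPdist_lt: uvt => /(_ _ er); apply: filterS => n un.
  rewrite sub0r normrN ger0_norm ?powR_ge0//.
  rewrite -[ltRHS](@powRr1 _ e) ?ltW// -(@mulVf _ r) ?gt_eqF// powRrM.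
  by apply: gt0_ltr_powR; rewrite ?nnegrE ?powR_ge0// distrC.
have f_dom : \forall t \ae mu, forall n, [set: T] t ->
    (`|f_ n t| <= ((2 `^ r)%:E * (`|g t| `^ r)%:E))%E.
  near=> t => n _; have ugt : forall n, `|u n t| <= `|g t| by near: t; exact: ug.
  have vgt : `|v t| <= `|g t| by near: t; exact: vg.
  have Et : forall n, (u n - v) t = u n t - v t by near: t; exact: subE.
  rewrite /f_ /= ger0_norm ?powR_ge0// lee_fin -powRM// Et.
  apply: ge0_ler_powR; rewrite ?nnegrE ?mulr_ge0// ?(ltW r0)//.
  by rewrite (le_trans (ler_normB _ _))// mulr_natl mulr2n lerD.
have ig : mu.-integrable [set: T] (fun t => ((2 `^ r)%:E * (`|g t| `^ r)%:E)%E).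
  apply: integrableZl => //; apply/integrableP; split.
    exact: measurable_norm_powR.
  under eq_integral do rewrite gee0_abs ?lee_fin ?powR_ge0//.
  rewrite (_ : integral _ _ _ = ('N[mu]_r%:E[EFin \o g] `^ r)%E).
    by apply: poweR_lty; exact: Lfun_finite_norm gp.
  by rewrite poweR_Lnorm// gt_eqF.
have [_ _] := @dominated_convergence _ _ _ mu _ measurableT f_ (cst 0%:E) _
  (fun n => measurable_norm_powR (Lval_measurable (u n - v)))
  (measurable_cst _) f_cvg ig f_dom.
rewrite integral0 => intf.
apply/cvgrPdist_lt => e e0.
have nf n : (\int[mu]_t f_ n t = (`|u n - v| `^ r)%:E)%E by rewrite Lspace_norm_powR.
have {}intf : (fun n => `|u n - v| `^ r) @ \oo --> 0.
  rewrite (_ : (fun n => _) = fine \o (fun n => \int[mu]_t f_ n t)%E).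
    exact: fine_cvg intf.
  by apply/funext => n /=; rewrite nf.
move/cvgrPdist_lt: intf => /(_ (e `^ r)); rewrite powR_gt0// => /(_ isT).
apply: filterS => n; rewrite sub0r normrN ger0_norm ?powR_ge0// => un.
rewrite distrC ltNge; apply/negP => en; move: un; rewrite ltNge => /negP; apply.
by apply: ge0_ler_powR; rewrite ?nnegrE ?(ltW r0) ?(ltW e0).
Unshelve. all: by end_near. Qed.

End Lspace_dominated_convergence.

Section linear_functional.
Context d (T : measurableType d) (R : realType).
Context (mu : {measure set T -> \bar R}) (r : R) (p1 : (1 <= r%:E)%E).

Local Notation Lp := (LspaceType mu p1).

Lemma Lfun_of_ae (f : T -> R) (u : Lp) : measurable_fun [set: T] f ->
  (\forall t \ae mu, f t = u t) -> f \in Lfun mu r%:E.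
Proof.
move=> mf fu; apply: (Lfun_le p1 mf (Lval_Lfun u)).
by apply: filterS fu => t ->.
Qed.

Context (l : {linear Lp -> R}) (lcont : continuous l).

(** The functional as acting on integrable functions instead of classes. *)
Definition on_functions (f : T -> R) : R := l (Lclass mu p1 f).

Local Notation L := on_functions.

Lemma Lfun_lin a b (f g : T -> R) : f \in Lfun mu r%:E -> g \in Lfun mu r%:E ->
  (fun t => a * f t + b * g t) \in Lfun mu r%:E /\
  L (fun t => a * f t + b * g t) = a * L f + b * L g.
Proof.
move=> fp gp; have mf := Lfun_measurable fp; have mg := Lfun_measurable gp.
pose u : Lp := a *: Lclass mu p1 f + b *: Lclass mu p1 g.
have uE : \forall t \ae mu, a * f t + b * g t = u t.
  near=> t; rewrite (near (Lval_add (a *: Lclass mu p1 f) (b *: Lclass mu p1 g)) t)//.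
  rewrite (near (Lval_scale a (Lclass mu p1 f)) t)//.
  rewrite (near (Lval_scale b (Lclass mu p1 g)) t)//.
  by rewrite (near (LclassE p1 fp) t)// (near (LclassE p1 gp) t).
have up : (fun t => a * f t + b * g t) \in Lfun mu r%:E.
  apply: (Lfun_of_ae _ uE).
  by apply: measurable_funD; exact: measurable_funM.
by split => //; rewrite /L (Lclass_eq up uE) linearD/= !linearZ.
Unshelve. all: by end_near. Qed.

Lemma on_functions0 : (cst 0 : T -> R) \in Lfun mu r%:E /\ L (cst 0) = 0.
Proof.
have zE : \forall t \ae mu, cst 0 t = (0 : Lp) t.
  by apply: filterS (Lval_zero mu p1) => t ->.
have z0 : (cst 0 : T -> R) \in Lfun mu r%:E by exact: Lfun_of_ae zE.
by split => //; rewrite /L (Lclass_eq z0 zE) linear0.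
Qed.

Lemma on_functions_dominated_cvg (f_ : nat -> T -> R) (f g : T -> R) :
  (forall n, measurable_fun [set: T] (f_ n)) -> measurable_fun [set: T] f ->
  g \in Lfun mu r%:E -> (forall n t, `|f_ n t| <= g t) ->
  (forall t, f_ ^~ t @ \oo --> f t) -> L \o f_ @ \oo --> L f.
Proof.
move=> mf_ mf gp fg f_f.
have g0 t : 0 <= g t by exact: le_trans (fg 0%N t).
have f_p n : f_ n \in Lfun mu r%:E.
  apply: (Lfun_le p1 (mf_ n) gp); apply: aeW => t.
  by rewrite [leRHS]ger0_norm// fg.
have fp : f \in Lfun mu r%:E.
  apply: (Lfun_le p1 mf gp); apply: aeW => t; rewrite [leRHS]ger0_norm//.
  by apply: (cvgr_to_le (cvg_norm (f_f t))); apply: nearW.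
have clE : (fun n => Lclass mu p1 (f_ n)) @ \oo --> Lclass mu p1 f; last first.
  rewrite (_ : L \o f_ = l \o (fun n => Lclass mu p1 (f_ n)))//.
  exact: (cvg_comp _ _ clE (@lcont _)).
apply: (Lspace_dominated_cvg gp) => [|n].
- have f_E : \forall t \ae mu, forall n, Lclass mu p1 (f_ n) t = f_ n t.
    by apply: ae_foralln => n; exact: LclassE.
  near=> t; rewrite (near (LclassE p1 fp) t)//.
  have f_Et : forall n, Lclass mu p1 (f_ n) t = f_ n t by near: t; exact: f_E.
  by rewrite (_ : (fun n => _) = f_ ^~ t)//; apply/funext => n; rewrite f_Et.
- near=> t; rewrite (near (LclassE p1 (f_p n)) t)//.
  by rewrite [leRHS]ger0_norm// fg.
Unshelve. all: by end_near. Qed.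

Lemma on_functions_bound : exists2 C, 0 <= C & forall f, f \in Lfun mu r%:E ->
  exists2 N, 0 <= N & L f <= C * N /\ ((N `^ r)%:E = \int[mu]_t (`|f t| `^ r)%:E)%E.
Proof.
have [C C0 lC] : exists2 C, 0 <= C & forall x, `|l x| <= C * `|x|.
  have /linear_bounded_continuous/linear_boundedP := lcont.
  by move=> /pinfty_ex_gt0[C C0 lC]; exists C => //; exact: ltW.
exists C => // f fp; exists `|Lclass mu p1 f| => //; split.
  exact: le_trans (ler_norm _) (lC _).
rewrite Lspace_norm_powR; apply: ae_eq_integral => //.
- exact: measurable_norm_powR (Lval_measurable _).
- exact: measurable_norm_powR (Lfun_measurable fp).
- by apply: filterS (LclassE p1 fp) => t ->.
Qed.

End linear_functional.

Lemma sum_disjoint_indic (T : Type) (R : realType) (F : nat -> set T) :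
  trivIset [set: nat] F -> forall t,
  (forall n, 0 <= \sum_(0 <= i < n) (\1_(F i) t : R) <= 1) /\
  (fun n => \sum_(0 <= i < n) (\1_(F i) t : R)) @ \oo --> (\1_(\bigcup_i F i) t : R).
Proof.
move=> tF t; have [[j _ Fj]|nF] := pselect ((\bigcup_i F i) t); last first.
  have Fi i : \1_(F i) t = 0 :> R.
    by rewrite indicE memNset// => Fit; apply: nF; exists i.
  split => [n|]; first by rewrite big1// lexx ler01.
  rewrite (_ : (fun n => _) = cst 0); last by apply/funext => n; rewrite big1.
  by rewrite indicE memNset//; exact: cvg_cst.
have Fi i : \1_(F i) t = (i == j)%:R :> R.
  rewrite indicE; congr (nat_of_bool _)%:R; have [->|ij] := eqVneq i j; first by rewrite mem_set.
  apply/negbTE/negP => /set_mem Fit; move/eqP: ij; apply.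
  by apply: tF => //; exists t.
have sE n : \sum_(0 <= i < n) (\1_(F i) t : R) = (j < n)%:R.
  elim: n => [|n IH]; first by rewrite big_geq.
  rewrite big_nat_recr//= IH Fi ltnS; have [->|nj] := eqVneq j n.
    by rewrite ltnn leqnn add0r.
  by rewrite addr0 (ltn_neqAle j n) nj.
split => [n|]; first by rewrite sE; case: (j < n)%N; rewrite ?lexx ler01.
rewrite indicE mem_set; last by exists j.
apply: cvg_near_cst; exists j.+1 => // n /= jn.
by rewrite sE jn.
Qed.

Section density.
Context d (T : measurableType d) (R : realType).
Context (mu : {sigma_finite_measure set T -> \bar R}) (r : R) (p1 : (1 <= r%:E)%E).

Local Notation Lp := (LspaceType mu p1).

Context (l : {linear Lp -> R}) (lcont : continuous l).
Context (w : T -> R) (w0 : forall t, 0 < w t) (wp : w \in Lfun mu r%:E).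

Local Notation L := (on_functions l).

Let mw : measurable_fun [set: T] w.
Proof. exact: Lfun_measurable wp. Qed.

Let w_indic A : measurable A -> (fun t => w t * \1_A t) \in Lfun mu r%:E.
Proof.
move=> mA; apply: (Lfun_le p1 _ wp).
  by apply: measurable_funM => //; exact: measurable_indic.
apply: aeW => t; rewrite normrM ler_piMr// indicE.
by case: (t \in A); rewrite ?normr1 ?normr0.
Qed.

(** The signed measure whose density is sought; the weight [w] makes it finite
    on the whole space. *)
Let nu (A : set T) : \bar R := (L (fun t => w t * \1_A t))%:E.

Let nu0 : nu set0 = 0%E.
Proof.
rewrite /nu (_ : (fun t => _) = cst 0); first by rewrite (on_functions0 l).2.
by apply/funext => t; rewrite indic0 mulr0.
Qed.

Let nu_fin A : measurable A -> nu A \is a fin_num.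
Proof. by []. Qed.

Let nu_sigma_additive : semi_sigma_additive nu.
Proof.
move=> F mF tF mUF.
have sumE n : (fun t => w t * \sum_(0 <= i < n) \1_(F i) t) \in Lfun mu r%:E /\
    (\sum_(0 <= i < n) nu (F i) = (L (fun t => w t * \sum_(0 <= i < n) \1_(F i) t))%:E)%E.
  elim: n => [|n [IHp IH]].
    rewrite big_geq// (_ : (fun t => _) = cst 0); last first.
      by apply/funext => t; rewrite big_geq// mulr0.
    by have [z0 ->] := on_functions0 l.
  have [sp sL] := Lfun_lin l 1 1 IHp (w_indic (mF n)).
  rewrite (_ : (fun t => w t * _) = (fun t => 1 * (w t * \sum_(0 <= i < n) \1_(F i) t) +
      1 * (w t * \1_(F n) t))); last first.
    by apply/funext => t; rewrite big_nat_recr//= !mul1r mulrDr.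
  by split => //; rewrite sL big_nat_recr//= IH !mul1r EFinD.
have mS n : measurable_fun [set: T] (fun t => w t * \sum_(0 <= i < n) \1_(F i) t).
  exact: Lfun_measurable (sumE n).1.
rewrite (_ : (fun n => _) =
  EFin \o (L \o (fun n t => w t * \sum_(0 <= i < n) \1_(F i) t))); last first.
  by apply/funext => n; rewrite (sumE n).2.
apply: cvg_EFin; first exact: nearW.
apply: (on_functions_dominated_cvg lcont mS _ wp).
- by apply: measurable_funM => //; exact: measurable_indic.
- move=> n t; have [/(_ n)/andP[s0 s1] _] := sum_disjoint_indic R tF t.
  by rewrite normrM gtr0_norm// ler_piMr ?(ltW (w0 t))// ger0_norm.
- move=> t; have [_ st] := sum_disjoint_indic R tF t.
  by apply: cvgMl_tmp.
Qed.

Let nuC : {charge set T -> \bar R} :=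
  HB.pack nu (isCharge.Build d T R nu nu0 nu_fin nu_sigma_additive).

Let nu_dom : nuC `<< mu.
Proof.
apply/null_content_dominatesP => A mA muA.
have [z0 L0] := on_functions0 l; suff wA0 : L (fun t => w t * \1_A t) = 0.
  by rewrite -[LHS]/(nu A) /nu wA0.
rewrite -L0; congr (l _); apply: (Lclass_eq (w_indic mA)).
have : \forall t \ae mu, ~ A t by exists A; split => // t /contrapT.
move=> nA; near=> t; rewrite (near (LclassE p1 z0) t)//.
have At : ~ A t by near: t; exact: nA.
by rewrite indicE memNset// mulr0.
Unshelve. all: by end_near. Qed.

Lemma weighted_density : exists y0 : T -> R,
  mu.-integrable [set: T] (EFin \o y0) /\
  forall A, measurable A -> L (fun t => w t * \1_A t) = \int[mu]_(t in A) y0 t.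
Proof.
exists (fine \o Radon_Nikodym nuC mu).
have finE : EFin \o (fine \o Radon_Nikodym nuC mu) = Radon_Nikodym nuC mu.
  by apply/funext => t /=; rewrite fineK// Radon_Nikodym_fin_num.
split; first by rewrite finE; exact: Radon_Nikodym_integrable.
move=> A mA; rewrite /Rintegral.
rewrite (_ : (\int[mu]_(t in A) _)%E = nu A)//.
rewrite -[RHS]/(nuC A) (Radon_Nikodym_integral nu_dom mA).
by apply: eq_integral => t _; rewrite -[in RHS]finE.
Qed.

End density.

Section representation.
Import HBNNSimple.
Context d (T : measurableType d) (R : realType).
Context (mu : {measure set T -> \bar R}) (r : R) (p1 : (1 <= r%:E)%E).

Local Notation Lp := (LspaceType mu p1).

Context (l : {linear Lp -> R}) (lcont : continuous l).
Context (w : T -> R) (w0 : forall t, 0 < w t) (wp : w \in Lfun mu r%:E).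

Local Notation L := (on_functions l).

Context (y0 : T -> R) (iy0 : mu.-integrable [set: T] (EFin \o y0)).
Hypothesis y0E : forall A, measurable A ->
  L (fun t => w t * \1_A t) = \int[mu]_(t in A) y0 t.

Let mw : measurable_fun [set: T] w.
Proof. exact: Lfun_measurable wp. Qed.

Let my0 : measurable_fun [set: T] y0.
Proof. by apply/measurable_EFinP; exact: measurable_int iy0. Qed.

Let D := [set t | 0 <= y0 t].

Let mD : measurable D.
Proof.
have := measurable_lee measurableT (measurable_cst 0%E) (measurable_int _ iy0).
by rewrite setTI.
Qed.

(** The sign of the density: it turns the integrands below into nonnegative
    functions, to which monotone convergence applies. *)
Let sgn t : R := \1_D t - \1_(~` D) t.

Let sgnE t : sgn t = if 0 <= y0 t then 1 else -1.
Proof.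
rewrite /sgn !indicE; case: ifPn => h.
  by rewrite mem_set// memNset ?subr0//; apply.
by rewrite memNset ?mem_set ?sub0r//; exact/negP.
Qed.

Let msgn : measurable_fun [set: T] sgn.
Proof.
by apply: measurable_funB; apply: measurable_indic => //; exact: measurableC.
Qed.

Let norm_sgn t : `|sgn t| = 1.
Proof. by rewrite sgnE; case: ifP; rewrite ?normrN normr1. Qed.

Let sgn_sqr t : sgn t * sgn t = 1.
Proof. by rewrite sgnE; case: ifP; rewrite ?mulrNN mulr1. Qed.

Let sgn_y0 t : sgn t * y0 t = `|y0 t|.
Proof.
rewrite sgnE; case: ifPn => h; first by rewrite mul1r ger0_norm.
by rewrite mulN1r ltr0_norm// ltNge.
Qed.

Let y0_indic A : measurable A ->
  mu.-integrable [set: T] (fun t => (y0 t * \1_A t)%:E) /\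
  \int[mu]_(t in A) y0 t = \int[mu]_t (y0 t * \1_A t).
Proof.
move=> mA; split.
  apply: (le_integrable measurableT _ _ iy0).
    by apply/measurable_EFinP; apply: measurable_funM => //; exact: measurable_indic.
  move=> t _; rewrite lee_fin normrM ler_piMr// indicE.
  by case: (t \in A); rewrite ?normr1 ?normr0.
rewrite Rintegral_mkcond; apply: eq_Rintegral => t _.
by rewrite patchE indicE; case: ifP; rewrite ?mulr1 ?mulr0.
Qed.

(** Splitting [A] along the sign of the density reduces this to [y0E]. *)
Let density_sgn_indic A : measurable A ->
  [/\ (fun t => w t * sgn t * \1_A t) \in Lfun mu r%:E,
      mu.-integrable [set: T] (fun t => (`|y0 t| * \1_A t)%:E) &
      L (fun t => w t * sgn t * \1_A t) = \int[mu]_t (`|y0 t| * \1_A t)].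
Proof.
move=> mA; have mAD : measurable (A `&` D) by exact: measurableI.
have mAD' : measurable (A `&` ~` D) by apply: measurableI => //; exact: measurableC.
have w_indic B : measurable B -> (fun t => w t * \1_B t) \in Lfun mu r%:E.
  move=> mB; apply: (Lfun_le p1 _ wp).
    by apply: measurable_funM => //; exact: measurable_indic.
  apply: aeW => t; rewrite normrM ler_piMr// indicE.
  by case: (t \in B); rewrite ?normr1 ?normr0.
have [wsp wsL] := Lfun_lin l 1 (-1) (w_indic _ mAD) (w_indic _ mAD').
have sA t : sgn t * \1_A t = \1_(A `&` D) t - \1_(A `&` ~` D) t.
  by rewrite /sgn !indicI /= mulrBl ![_ * \1_A t]mulrC.
have wE : (fun t => w t * sgn t * \1_A t) =
    (fun t => 1 * (w t * \1_(A `&` D) t) + -1 * (w t * \1_(A `&` ~` D) t)).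
  by apply/funext => t; rewrite -mulrA sA mul1r mulN1r mulrBr.
have [i1 E1] := y0_indic mAD; have [i2 E2] := y0_indic mAD'.
have yE t : `|y0 t| * \1_A t = y0 t * \1_(A `&` D) t - y0 t * \1_(A `&` ~` D) t.
  by rewrite -sgn_y0 mulrAC sA mulrC mulrBr.
split; first by rewrite wE.
  rewrite (_ : (fun t => _) = (fun t => ((y0 t * \1_(A `&` D) t)%:E -
      (y0 t * \1_(A `&` ~` D) t)%:E)%E)).
    exact: integrableB.
  by apply/funext => t; rewrite yE EFinB.
rewrite wE wsL mul1r mulN1r !y0E// E1 E2 -RintegralB//.
by apply: eq_Rintegral => t _; rewrite yE.
Qed.

Let density_sgn_sum (S : seq R) (A : R -> set T) : (forall x, measurable (A x)) ->
  [/\ (fun t => w t * sgn t * \sum_(x <- S) x * \1_(A x) t) \in Lfun mu r%:E,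
      mu.-integrable [set: T] (fun t => (`|y0 t| * \sum_(x <- S) x * \1_(A x) t)%:E) &
      L (fun t => w t * sgn t * \sum_(x <- S) x * \1_(A x) t) =
      \int[mu]_t (`|y0 t| * \sum_(x <- S) x * \1_(A x) t)].
Proof.
move=> mA; elim: S => [|x S [Sp Si SL]].
  have [z0 L0] := on_functions0 l.
  have -> : (fun t => w t * sgn t * \sum_(x <- [::]) x * \1_(A x) t) = cst 0.
    by apply/funext => t; rewrite big_nil mulr0.
  have yE : (fun t => `|y0 t| * \sum_(x <- [::]) x * \1_(A x) t) = cst 0.
    by apply/funext => t; rewrite big_nil mulr0.
  split => //.
    rewrite (_ : (fun t => _) = cst 0%E); first exact: integrable0.
    by apply/funext => t; rewrite big_nil mulr0.
  by rewrite L0 yE /Rintegral integral0.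
have [xp xi xL] := density_sgn_indic (mA x).
have [Sxp SxL] := Lfun_lin l x 1 xp Sp.
have wE : (fun t => w t * sgn t * \sum_(x <- x :: S) x * \1_(A x) t) =
    (fun t => x * (w t * sgn t * \1_(A x) t) +
      1 * (w t * sgn t * \sum_(x <- S) x * \1_(A x) t)).
  by apply/funext => t; rewrite big_cons mul1r mulrDr mulrCA.
have yE t : `|y0 t| * \sum_(x <- x :: S) x * \1_(A x) t =
    x * (`|y0 t| * \1_(A x) t) + `|y0 t| * \sum_(x <- S) x * \1_(A x) t.
  by rewrite big_cons mulrDr mulrCA.
have xi' : mu.-integrable [set: T] (fun t => (x * (`|y0 t| * \1_(A x) t))%:E).
  rewrite (_ : (fun t => _) = (fun t => (x%:E * (`|y0 t| * \1_(A x) t)%:E)%E)).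
    exact: integrableZl.
  by apply/funext => t; rewrite EFinM.
split; first by rewrite wE.
  rewrite (_ : (fun t => _) = (fun t => ((x * (`|y0 t| * \1_(A x) t))%:E +
      (`|y0 t| * \sum_(x <- S) x * \1_(A x) t)%:E)%E)).
    exact: integrableD.
  by apply/funext => t; rewrite yE EFinD.
rewrite wE SxL mul1r xL SL -RintegralZl// -RintegralD//.
by apply: eq_Rintegral => t _; rewrite yE.
Qed.

Let density_sgn_simple (s : {nnsfun T >-> R}) :
  [/\ (fun t => w t * sgn t * s t) \in Lfun mu r%:E,
      mu.-integrable [set: T] (fun t => (`|y0 t| * s t)%:E) &
      L (fun t => w t * sgn t * s t) = \int[mu]_t (`|y0 t| * s t)].
Proof.
pose S : seq R := finmap.enum_fset (fset_set (range s)).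
have sE t : s t = \sum_(x <- S) x * \1_(s @^-1` [set x]) t.
  by rewrite [LHS]fimfunE fsbig_finite//.
have := @density_sgn_sum S (fun x => s @^-1` [set x])
  (fun x => measurable_funPTI s (measurable_set1 x)).
rewrite (_ : (fun t => w t * sgn t * \sum_(x <- _) _) = (fun t => w t * sgn t * s t)).
  rewrite (_ : (fun t => (`|y0 t| * \sum_(x <- _) _)%:E) = (fun t => (`|y0 t| * s t)%:E)).
    rewrite (_ : (fun t => (`|y0 t| * \sum_(x <- _) _)) = (fun t => (`|y0 t| * s t)))//.
    by apply/funext => t; rewrite sE.
  by apply/funext => t; rewrite sE.
by apply/funext => t; rewrite sE.
Qed.

(** Both sides are limits of their values at [w s_n] with [s_n] simple and
    increasing to [f / w]: the left one by dominated convergence in L^p, the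
    right one by monotone convergence. *)
Lemma density_sgn (f : T -> R) : (forall t, 0 <= f t) -> f \in Lfun mu r%:E ->
  ((L (fun t => sgn t * f t))%:E = \int[mu]_t (`|y0 t / w t| * f t)%:E)%E.
Proof.
move=> f0 fp; have mf := Lfun_measurable fp.
have wu t : w t != 0 by rewrite gt_eqF.
have mfw : measurable_fun [set: T] (fun t => (f t / w t)%:E).
  apply/measurable_EFinP; apply: measurable_funM => //.
  rewrite (_ : (fun t => (w t)^-1) = (fun t => w t `^ (-1))).
    exact: (measurableT_comp (measurable_powR _) mw).
  by apply/funext => t; rewrite powR_inv1// ltW.
have fw0 t : [set: T] t -> (0 <= (f t / w t)%:E)%E.
  by move=> _; rewrite lee_fin divr_ge0// ltW.
pose s := nnsfun_approx measurableT mfw.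
have s_f t : (fun n => s n t) @ \oo --> f t / w t.
  have /fine_cvg := @cvg_nnsfun_approx _ _ _ _ measurableT _ mfw fw0 t I.
  exact.
have s_nd t m n : (m <= n)%N -> s m t <= s n t.
  by move=> mn; have /lefP := nd_nnsfun_approx measurableT mfw mn; exact.
have s_le n t : s n t <= f t / w t.
  by apply: (cvgr_to_ge (s_f t)); exists n => // m /= /s_nd.
have s0 n t : 0 <= s n t by exact: fun_ge0.
have sL n := density_sgn_simple (s n).
have Lcvg : (fun n => L (fun t => w t * sgn t * s n t)) @ \oo --> L (fun t => sgn t * f t).
  apply: (on_functions_dominated_cvg lcont _ _ fp).
  + by move=> n; have [/Lfun_measurable] := sL n.
  + exact: measurable_funM.
  + move=> n t; rewrite !normrM norm_sgn mulr1 gtr0_norm// ger0_norm//.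
    by rewrite mulrC -ler_pdivlMr.
  + move=> t; rewrite [X in _ --> X](_ : _ = w t * sgn t * (f t / w t)).
      by apply: cvgMl_tmp; exact: s_f.
    by rewrite mulrA mulrAC [w t * sgn t]mulrC mulrK ?unitfE.
have Icvg : (\int[mu]_t (`|y0 t| * s n t)%:E)%E @[n --> \oo] -->
    (\int[mu]_t (`|y0 t / w t| * f t)%:E)%E.
  rewrite (_ : (\int[mu]_t (`|y0 t / w t| * f t)%:E)%E =
      (\int[mu]_t limn (fun n => (`|y0 t| * s n t)%:E))%E); last first.
    apply: eq_integral => t _; apply/esym/cvg_lim => //.
    apply: cvg_EFin; first exact: nearW.
    rewrite [X in _ --> X](_ : _ = `|y0 t| * (f t / w t)).
      by apply: cvgMl_tmp; exact: s_f.
    by rewrite normrM normfV (gtr0_norm (w0 t)) mulrAC mulrA.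
  apply: cvg_monotone_convergence => //.
  + by move=> n; have [_ /(measurable_int _)] := sL n.
  + by move=> n t _; rewrite lee_fin mulr_ge0.
  + by move=> t _ m n mn; rewrite lee_fin ler_wpM2l// s_nd.
apply: (cvg_unique _ _ Icvg) => //.
rewrite (_ : (fun n => _) = EFin \o (fun n => L (fun t => w t * sgn t * s n t))).
  by apply: cvg_EFin; first exact: nearW.
apply/funext => n /=; have [_ si ->] := sL n.
by rewrite /Rintegral fineK//; exact: integrable_fin_num.
Qed.

Let y t : R := y0 t / w t.

Let my : measurable_fun [set: T] y.
Proof.
apply: measurable_funM => //.
rewrite (_ : (fun t => (w t)^-1) = (fun t => w t `^ (-1))).
  exact: (measurableT_comp (measurable_powR _) mw).
by apply/funext => t; rewrite powR_inv1// ltW.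
Qed.

Let y_bound : exists2 C, 0 <= C & forall f : T -> R, (forall t, 0 <= f t) ->
  f \in Lfun mu r%:E -> exists2 N, 0 <= N &
    (\int[mu]_t (`|y t| * f t)%:E <= (C * N)%:E)%E /\
    ((N `^ r)%:E = \int[mu]_t (`|f t| `^ r)%:E)%E.
Proof.
have [C C0 LC] := on_functions_bound lcont; exists C => // f f0 fp.
have sfp : (fun t => sgn t * f t) \in Lfun mu r%:E.
  apply: (Lfun_le p1 _ fp).
    by apply: measurable_funM => //; exact: Lfun_measurable fp.
  by apply: aeW => t; rewrite normrM norm_sgn mul1r.
have [N N0 [LN NE]] := LC _ sfp; exists N => //; split.
  by rewrite -density_sgn// lee_fin.
rewrite NE; apply: eq_integral => t _.
by rewrite normrM norm_sgn mul1r.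
Qed.

(** Sets exhausting the space on which [y] is bounded and which have finite
    measure, because the integrable weight is bounded below on them. *)
Let E n := [set t | `|y t| <= n%:R /\ 1 <= n.+1%:R * w t].

Let mE n : measurable (E n).
Proof.
have -> : E n = [set t | ((`|y t|)%:E <= (n%:R)%:E)%E] `&`
    [set t | (1%:E <= (n.+1%:R * w t)%:E)%E] by [].
have mle (u v : T -> R) : measurable_fun [set: T] u -> measurable_fun [set: T] v ->
    measurable [set t | ((u t)%:E <= (v t)%:E)%E].
  move=> /measurable_EFinP mu_ /measurable_EFinP mv.
  by have := measurable_lee measurableT mu_ mv; rewrite setTI.
by apply: measurableI; apply: mle => //;
  [exact: measurableT_comp|exact: measurable_funM].
Qed.

Let subset_E m n : (m <= n)%N -> E m `<=` E n.
Proof.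
move=> mn t [ym wm]; split; first by rewrite (le_trans ym)// ler_nat.
by rewrite (le_trans wm)// ler_wpM2r ?ler_nat// ltW.
Qed.

Let E_cover t : exists n, forall m, (n <= m)%N -> E m t.
Proof.
pose n := maxn (Num.bound `|y t|) (Num.bound (w t)^-1).
exists n => m nm; apply: (subset_E nm); split.
  rewrite (le_trans (ltW (archi_boundP _)))// ler_nat.
  exact: leq_maxl.
rewrite -ler_pdivrMr// mul1r.
have wi : 0 <= (w t)^-1 by rewrite invr_ge0 ltW.
rewrite (le_trans (ltW (archi_boundP wi)))// ler_nat.
exact: leq_trans (leq_maxr _ _) (leqnSn _).
Qed.

Let Lfun_on_E (f : T -> R) n c : measurable_fun [set: T] f -> 0 <= c ->
  (forall t, `|f t| <= c * \1_(E n) t) -> f \in Lfun mu r%:E.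
Proof.
move=> mf c0 fc; have [gp _] := Lfun_lin l (c * n.+1%:R) 0 wp wp.
apply: (Lfun_le p1 mf gp); apply: aeW => t.
rewrite mul0r addr0 [leRHS]ger0_norm ?mulr_ge0//; last exact: ltW.
rewrite (le_trans (fc t))// -mulrA ler_wpM2l// indicE.
have [/set_mem[_ //]|_] := boolP (t \in E n).
by rewrite mulr_ge0// ltW.
Qed.

(** Testing against [|y|^(s-1)] on [E n] bounds the integral [J] of [|y|^s]
    over [E n] by [C J^(1/r)], hence [J] by [C^s]. *)
Let density_Lfun_finite (s : R) : 1 < r -> 1 < s -> r^-1 + s^-1 = 1 ->
  y \in Lfun mu s%:E.
Proof.
move=> r1 s1 rs; have r0 : 0 < r by exact: lt_trans r1.
have s0 : 0 < s by exact: lt_trans s1.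
have rsE' : (r - 1) * s = r.
  have -> : r - 1 = s^-1 * r.
    by rewrite -[s^-1](addKr r^-1) rs mulrDl mulNr mul1r mulVf ?gt_eqF// addrC.
  by rewrite mulrAC mulVf ?mul1r// gt_eqF.
have rsE : (s - 1) * r = s by move: rsE'; lra.
have [C C0 yC] := y_bound.
pose J n := (\int[mu]_t (`|y t| `^ s * \1_(E n) t)%:E)%E.
have mys : measurable_fun [set: T] (fun t => `|y t| `^ s).
  by apply: (measurableT_comp (measurable_powR _)); exact: measurableT_comp.
have JC n : (J n <= (C `^ s)%:E)%E.
  pose f t := `|y t| `^ (s - 1) * \1_(E n) t.
  have f0 t : 0 <= f t by rewrite mulr_ge0// powR_ge0.
  have fp : f \in Lfun mu r%:E.
    apply: (@Lfun_on_E _ n (n%:R `^ (s - 1))) => //.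
    - apply: measurable_funM; last exact: measurable_indic.
      by apply: (measurableT_comp (measurable_powR _)); exact: measurableT_comp.
    - move=> t; rewrite ger0_norm// /f indicE.
      have [/set_mem[yn _]|_] := boolP (t \in E n); last by rewrite !mulr0.
      by rewrite !mulr1 ge0_ler_powR ?nnegrE// subr_ge0 ltW.
  have [N N0 [IN NE]] := yC f f0 fp.
  have fJ : (J n = \int[mu]_t (`|y t| * f t)%:E)%E.
    by apply: eq_integral => t _; rewrite /f mulrA mulr_powRB1.
  have NJ : ((N `^ r)%:E = J n)%E.
    rewrite NE; apply: eq_integral => t _; rewrite ger0_norm// /f indicE.
    case: (t \in E n); last by rewrite !mulr0 powR0// gt_eqF.
    by rewrite !mulr1 -powRrM rsE.
  move: IN; rewrite -fJ -NJ !lee_fin => NC.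
  have [->|Nn0] := eqVneq N 0; first by rewrite powR0 ?gt_eqF// powR_ge0.
  have Np : 0 < N by rewrite lt_def Nn0.
  have : N `^ (r - 1) <= C by rewrite -(ler_pM2l Np) mulr_powRB1// [N * C]mulrC.
  rewrite -{2}rsE' powRrM => h.
  by apply: ge0_ler_powR; rewrite ?nnegrE ?powR_ge0// ltW.
apply: LfunI => //; rewrite unlock /Lnorm; apply: poweR_lty.
apply: (@le_lt_trans _ _ (C `^ s)%:E); last exact: ltry.
have Jcvg : J n @[n --> \oo] --> (\int[mu]_t `|(EFin \o y) t| `^ s)%E.
  rewrite (_ : (\int[mu]_t `|(EFin \o y) t| `^ s)%E =
      (\int[mu]_t limn (fun n => (`|y t| `^ s * \1_(E n) t)%:E))%E); last first.
    apply: eq_integral => t _; apply/esym/cvg_lim => //.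
    apply: cvg_near_cst; have [n nE] := E_cover t.
    exists n => // m /= nm; rewrite indicE mem_set ?mulr1//; exact: nE.
  apply: cvg_monotone_convergence => //.
  + by move=> n; apply/measurable_EFinP; apply: measurable_funM => //; exact: measurable_indic.
  + move=> t _ m n mn; rewrite lee_fin ler_wpM2l ?powR_ge0// !indicE.
    have [/set_mem/(subset_E mn)|_] := boolP (t \in E m); last by [].
    by move=> Et; rewrite mem_set.
by apply: (cvge_to_le Jcvg); exact: nearW.
Qed.

(** Testing against the indicator of a part of [E n] where [|y| > C]. *)
Let density_Lfun_infinite : r = 1 -> y \in Lfun mu +oo%E.
Proof.
move=> r1; have [C C0 yC] := y_bound.
pose A n := E n `&` [set t | C < `|y t|].
have mA n : measurable (A n).
  apply: measurableI => //.
  have myE : measurable_fun [set: T] (EFin \o (fun t => `|y t|)).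
    by apply/measurable_EFinP; exact: measurableT_comp.
  by have := measurable_lte measurableT (measurable_cst C%:E) myE; rewrite setTI.
have A0 n : \forall t \ae mu, ~ A n t.
  have A1 t : `|\1_(A n) t| = \1_(A n) t :> R.
    by rewrite indicE; case: (t \in A n); rewrite ?normr1 ?normr0.
  have Ap : (\1_(A n) : T -> R) \in Lfun mu r%:E.
    apply: (@Lfun_on_E _ n 1) => // t; rewrite A1 mul1r indicI /= ler_piMr//.
  have A_ge0 t : 0 <= \1_(A n) t :> R by rewrite -A1.
  have [N N0 [IN NE]] := yC _ A_ge0 Ap.
  pose k t := (`|y t| - C) * \1_(A n) t.
  have mk : measurable_fun [set: T] k.
    apply: measurable_funM; last exact: measurable_indic.
    by apply: measurable_funB => //; exact: measurableT_comp.
  have k0 t : 0 <= k t.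
    rewrite /k indicE; have [/set_mem[_ Ct]|_] := boolP (t \in A n); last by rewrite mulr0.
    by rewrite mulr1 subr_ge0 ltW.
  have ik : (\int[mu]_t (k t)%:E <= 0)%E.
    have NA : (N%:E = \int[mu]_t (\1_(A n) t)%:E)%E.
      rewrite -[N]powRr1// -[X in N `^ X]r1 NE; apply: eq_integral => t _.
      by rewrite A1 r1 powRr1// -A1.
    have CA : (\int[mu]_t (C * \1_(A n) t)%:E = (C * N)%:E)%E.
      rewrite EFinM NA -ge0_integralZl_EFin//; last exact/measurable_EFinP/measurable_indic.
    move: IN; rewrite -CA (_ : (\int[mu]_t (`|y t| * _)%:E)%E =
        (\int[mu]_t (k t)%:E + \int[mu]_t (C * \1_(A n) t)%:E)%E).
      by rewrite CA -leeBrDr// subee//.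
    rewrite -ge0_integralD//.
    + by apply: eq_integral => t _; rewrite -EFinD /k -mulrDl subrK.
    + by move=> t _; rewrite lee_fin.
    + exact/measurable_EFinP.
    + by move=> t _; rewrite lee_fin mulr_ge0.
    + by apply/measurable_EFinP; apply: measurable_funM => //; exact: measurable_indic.
  apply: filterS (integral_le0_ae0 mk k0 ik) => t + At.
  rewrite /k indicE mem_set// mulr1 => /eqP; rewrite subr_eq0 => /eqP yCE.
  by move: At => [_ /=]; rewrite yCE ltxx.
apply: LfunI => //; rewrite unlock /Lnorm; case: ifP => // _.
apply: (@le_lt_trans _ _ C%:E); last exact: ltry.
apply/ess_supP; apply: filterS (ae_foralln A0) => t nA; rewrite /= lee_fin leNgt.
apply/negP => yt; have [n nE] := E_cover t; apply: (nA n); split => //.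
exact: nE.
Qed.

Context (q : \bar R) (q1 : (1 <= q)%E) (pq : (r%:E^-1 + q^-1 = 1)%E).

(** The general case follows from [density_sgn] applied to the positive and
    negative parts of [sgn v]. *)
Lemma density_in_dual : in_Lspace_dual q1 l.
Proof.
have yq : y \in Lfun mu q.
  have [[r1 ->]|[//]|[r' [s [[<-] -> r1 s1 rs]]]] := conjugate_exponents p1 q1 pq.
    by apply: density_Lfun_infinite; case: r1.
  exact: density_Lfun_finite.
exists (Lclass mu q1 y) => v.
have mv := Lval_measurable v; have vp := Lval_Lfun v.
pose f t := sgn t * v t; pose fp t := Num.max (f t) 0; pose fn t := Num.max (- f t) 0.
have mf : measurable_fun [set: T] f by exact: measurable_funM.
have fE t : `|f t| = `|v t| by rewrite normrM norm_sgn mul1r.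
have part (e : R) (g : T -> R) : `|e| = 1 -> g = (fun t => Num.max (e * f t) 0) ->
    (fun t => sgn t * g t) \in Lfun mu r%:E /\
    mu.-integrable [set: T] (fun t => (`|y t| * g t)%:E) /\
    L (fun t => sgn t * g t) = \int[mu]_t (`|y t| * g t).
  move=> e1 gE.
  have g0 t : 0 <= g t by rewrite gE le_max lexx orbT.
  have mg : measurable_fun [set: T] g.
    by rewrite gE; apply: measurable_maxr => //; exact: measurable_funM.
  have gv t : `|g t| <= `|v t|.
    rewrite ger0_norm// gE ge_max normr_ge0 andbT -fE.
    by rewrite (le_trans (ler_norm _))// normrM e1 mul1r.
  have gp : g \in Lfun mu r%:E by apply: (Lfun_le p1 mg vp); exact: aeW.
  have LE := density_sgn g0 gp.
  split; last split.
  - apply: (Lfun_le p1 _ vp); first exact: measurable_funM.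
    by apply: aeW => t; rewrite normrM norm_sgn mul1r.
  - apply/integrableP; split.
      apply/measurable_EFinP; apply: measurable_funM => //.
      exact: measurableT_comp.
    under eq_integral do rewrite gee0_abs ?lee_fin ?mulr_ge0//.
    by rewrite -LE ltry.
  - by rewrite /Rintegral -LE.
have [||pp [ip Lp_]] := part 1 fp; rewrite ?normr1//.
  by apply/funext => t; rewrite /fp mul1r.
have [||pn [in_ Ln]] := part (-1) fn; rewrite ?normrN ?normr1//.
  by apply/funext => t; rewrite /fn mulN1r.
have [_ vL] := Lfun_lin l 1 (-1) pp pn.
have fpn t : fp t - fn t = f t.
  rewrite /fp /fn /Num.max oppr_lt0.
  by case: ltgtP => h; rewrite ?subr0 ?sub0r ?opprK// h ?oppr0 ?addr0.
have -> : l v = L v by rewrite /on_functions (Lclass_eq vp (aeW _ (fun=> erefl))).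
rewrite (_ : (v : T -> R) = (fun t => 1 * (sgn t * fp t) + -1 * (sgn t * fn t))); last first.
  by apply/funext => t; rewrite mul1r mulN1r -mulrBr fpn /f mulrA sgn_sqr mul1r.
rewrite vL mul1r mulN1r Lp_ Ln -RintegralB//.
rewrite [RHS](pairing_ae (k := fun t => `|y t| * fp t - `|y t| * fn t))//.
- apply: measurable_funB; apply/measurable_EFinP; first exact: measurable_int ip.
  exact: measurable_int in_.
- near=> t; have -> : (Lclass mu q1 y) t = y t by near: t; exact: LclassE.
  rewrite -mulrBr fpn /f mulrA; congr (_ * _).
  by rewrite /y normrM normfV (gtr0_norm (w0 t)) -sgn_y0 mulrAC (mulrAC (sgn t)) sgn_sqr mul1r.
Unshelve. all: by end_near. Qed.

End representation.

(** Riesz representation. The weight makes the set function [l (w \1_A)] finite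
    on the whole space, so that a single application of Radon-Nikodym suffices
    although [mu] is only sigma-finite. *)
Lemma Lspace_dual d (T : measurableType d) (R : realType)
    (mu : {sigma_finite_measure set T -> \bar R}) (p q : \bar R)
    (p1 : (1 <= p)%E) (q1 : (1 <= q)%E) (pq : (p^-1 + q^-1 = 1)%E)
    (l : {linear LspaceType mu p1 -> R}) :
  p != +oo%E -> continuous l -> in_Lspace_dual q1 l.
Proof.
case: p p1 pq l => [r||] p1 pq l //= _ lcont.
have r1 : 1 <= r by rewrite -lee_fin.
have [w [w0 wp]] := positive_Lfun_exists mu r1.
have [y0 [iy0 y0E]] := weighted_density lcont w0 wp.
exact: (density_in_dual lcont w0 wp iy0 y0E q1 pq).
Qed.

(** * Normal cones and multipliers *)

Section constraint_system.
Context d (T : measurableType d) (R : realType).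
Context (mu : {sigma_finite_measure set T -> \bar R}).
Context (p q : \bar R) (p1 : (1 <= p)%E) (q1 : (1 <= q)%E).
Hypothesis pq : (p^-1 + q^-1 = 1)%E.

Local Notation Lp := (LspaceType mu p1).
Local Notation Lq := (LspaceType mu q1).

Context (xa xb : T -> \bar R).
Hypothesis mxa : measurable_fun [set: T] xa.
Hypothesis mxb : measurable_fun [set: T] xb.
Context (n m N : nat) (g : 'I_n -> Lq) (a : 'I_n -> R).
Context (h : 'I_m -> Lq) (b : 'I_m -> R) (G : 'I_N -> Lp -> R).
Hypothesis G_diff : forall i x, differentiable (G i) x.

Local Notation K := (box mu p1 xa xb).
Local Notation P := (polyhedron g a h b).
Local Notation Q := (nonlinear_constraints G).
Local Notation E := (K `&` P `&` Q).

Context (xbar : Lp) (Exbar : E xbar).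

Local Notation A := [pred i | pairing (g i) xbar == a i].
Local Notation B := [pred i | G i xbar == 0].

(** Inactive constraints persist near [xbar] by continuity; active ones are
    linear, or decrease strictly along [v]. *)
Lemma linearized_direction_tangent (v : Lp) : K (xbar + v) ->
  (forall i, i \in A -> pairing (g i) v <= 0) ->
  (forall j, pairing (h j) v = 0) ->
  (forall i, i \in B -> 'd (G i) xbar v < 0) ->
  tangent_cone E xbar v.
Proof.
move=> Kv gv hv Gv; case: Exbar => -[Kx [gx hx]] Qx.
have near_g i : \forall s \near 0^'+, pairing (g i) (xbar + s *: v) <= a i.
  have [iA|iA] := boolP (i \in A).
    near=> s; have s0 : 0 < s by near: s; exact: nbhs_right_gt.
    rewrite pairingDr// pairingZr// (eqP (iA : _ == _)).
    by rewrite gerDl mulr_ge0_le0 ?gv// ltW.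
  have gxi : pairing (g i) xbar < a i by rewrite lt_neqAle iA gx.
  have c : pairing (g i) xbar + s * pairing (g i) v @[s --> 0^'+] --> pairing (g i) xbar.
    rewrite -[X in _ --> X]addr0; apply: cvgD; first exact: cvg_cst.
    rewrite -[X in _ --> X](mul0r (pairing (g i) v)); apply: cvgMr_tmp.
    by apply: cvg_at_right_filter; exact: cvg_id.
  near=> s; rewrite pairingDr// pairingZr//; near: s.
  by move/cvgr_le : c; exact.
have near_G i : \forall s \near 0^'+, G i (xbar + s *: v) <= 0.
  have [iB|iB] := boolP (i \in B).
    have := diff_lt0_decrease (G_diff i xbar) (Gv i iB).
    by apply: filterS => s; rewrite (eqP (iB : _ == _)) => /ltW.
  have Gxi : G i xbar < 0 by rewrite lt_neqAle iB Qx.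
  have c : G i (xbar + s *: v) @[s --> 0^'+] --> G i xbar.
    have Gc : G i z @[z --> xbar] --> G i xbar by apply: differentiable_continuous.
    exact: (cvg_comp _ _ (@line_cvg_right _ _ xbar v) Gc).
  by move/cvgr_le : c; exact.
apply: feasible_direction_tangent; near=> s.
have s0 : 0 < s by near: s; exact: nbhs_right_gt.
have s1 : s <= 1 by near: s; exact: nbhs_right_le.
split; [split|].
- have -> : xbar + s *: v = s *: (xbar + v) + (1 - s) *: xbar.
    by rewrite scalerDr addrAC -scalerDl [s + _]addrC subrK scale1r.
  by apply: (box_convex Kv Kx) => //; exact: ltW.
- split.
    by near: s; exact: filter_forall.
  by move=> j; rewrite pairingDr// pairingZr// hv mulr0 addr0.
- by near: s; exact: filter_forall.
Unshelve. all: by end_near. Qed.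

Context (dG : 'I_N -> Lq).
Hypothesis dGE : forall i v, 'd (G i) xbar v = pairing (dG i) v.

Context (xt : Lp).
Hypothesis xt_strict : \forall t \ae mu, (xa t < (xt t)%:E < xb t)%E.
Hypothesis xt_g : forall i, pairing (g i) xt <= a i.
Hypothesis xt_G : forall i, i \in B -> 'd (G i) xbar (xt - xbar) < 0.
Hypothesis xt_h : forall j, pairing (h j) xt = b j.

Let C := [set v : Lp | K (xbar + v)].

Let Kxt : K xt.
Proof. by apply: filterS xt_strict => t /andP[/ltW-> /ltW->]. Qed.

Let C_convex : convex_subset C.
Proof.
move=> u v s Cu Cv s0 s1; rewrite /C/=.
have -> : xbar + (s *: u + (1 - s) *: v) = s *: (xbar + u) + (1 - s) *: (xbar + v).
  by rewrite !scalerDr addrACA -scalerDl [s + _]addrC subrK scale1r.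
exact: box_convex.
Qed.

Let d0 := xt - xbar.

Let Cd0 : C d0.
Proof. by rewrite /C/= /d0 addrC subrK. Qed.

Let gd0 i : i \in A -> pairing (g i) d0 <= 0.
Proof. by move=> /eqP iA; rewrite pairingBr// iA subr_le0. Qed.

Let hd0 j : pairing (h j) d0 = 0.
Proof. by case: Exbar => -[_ [_ hx]] _; rewrite pairingBr// hx xt_h subrr. Qed.

Let d0_inner (w : Lq) :
  (forall v, C v -> pairing w v <= 0) -> 0 <= pairing w d0 -> w = 0.
Proof.
move=> Cw w0; apply: (box_inner pq mxa mxb xt_strict) => x Kx.
have : pairing w (x - xbar) <= 0 by apply: Cw; rewrite /C/= addrC subrK.
by move: w0; rewrite /d0 !pairingBr//; lra.
Qed.

(** One index type for the three families, so that [multipliers] can move a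
    constraint from the inequalities to the equalities. *)
Let index : Type := ('I_n + 'I_N + 'I_m)%type.

Let constraint (k : index) : Lq :=
  match k with inl (inl i) => g i | inl (inr i) => dG i | inr j => h j end.

Let ineqs : seq index :=
  [seq inl (inl i) | i <- enum A] ++ [seq inl (inr i) | i <- enum B].

Let eqs : seq index := [seq inr j | j <- enum 'I_m].

Let uniq_constraints : uniq (ineqs ++ eqs).
Proof.
have uA : uniq [seq inl (inl i) : index | i <- enum A].
  by rewrite map_inj_uniq ?enum_uniq// => i i' [].
have uB : uniq [seq inl (inr i) : index | i <- enum B].
  by rewrite map_inj_uniq ?enum_uniq// => i i' [].
have uH : uniq eqs by rewrite map_inj_uniq ?enum_uniq// => j j' [].
rewrite !cat_uniq uA uB uH !andbT /=; apply/andP; split.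
- by apply/hasPn => k /mapP[j _ ->]; apply/negP => /mapP[].
- apply/hasPn => k /mapP[j _ ->]; apply/negP.
  by rewrite mem_cat => /orP[] /mapP[].
Qed.

Let feasibleE v : feasible (@pairing _ _ _ mu p q p1 q1) constraint ineqs eqs v <->
  [/\ forall i, i \in A -> pairing (g i) v <= 0,
      forall i, i \in B -> pairing (dG i) v <= 0 &
      forall j, pairing (h j) v = 0].
Proof.
split => [[le0 eq0]|[gv dGv hv]].
  split => [i iA|i iB|j].
  - apply: (le0 (inl (inl i))); rewrite mem_cat; apply/orP; left.
    by apply: map_f; rewrite mem_enum.
  - apply: (le0 (inl (inr i))); rewrite mem_cat; apply/orP; right.
    by apply: map_f; rewrite mem_enum.
  - by apply: (eq0 (inr j)); apply: map_f; rewrite mem_enum.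
split => k; last by move=> /mapP[j _ ->]; exact: hv.
rewrite mem_cat => /orP[] /mapP[i]; rewrite mem_enum => iAB -> /=.
- exact: gv.
- exact: dGv.
Qed.

(** Moving slightly towards the Slater point makes the linearized nonlinear
    constraints strict, which gives tangent directions. *)
Let normal_le0 (y : Lq) (v : Lp) : normal_cone q1 E xbar y -> C v ->
  (forall i, i \in A -> pairing (g i) v <= 0) ->
  (forall i, i \in B -> pairing (dG i) v <= 0) ->
  (forall j, pairing (h j) v = 0) -> pairing y v <= 0.
Proof.
move=> Ny Cv gv Gv hv.
have le0 s : 0 < s -> s <= 1 -> s * pairing y d0 + (1 - s) * pairing y v <= 0.
  move=> s0 s1; rewrite -!pairingZr// -pairingDr//; apply: Ny.
  apply: linearized_direction_tangent.
  - by apply: C_convex => //; exact: ltW.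
  - move=> i iA; rewrite pairingDr// !pairingZr// -(addr0 0) lerD//.
      by rewrite mulr_ge0_le0 ?gd0// ltW.
    by rewrite mulr_ge0_le0 ?gv// subr_ge0.
  - by move=> j; rewrite pairingDr// !pairingZr// hd0 hv !mulr0 addr0.
  - move=> i iB; rewrite dGE pairingDr// !pairingZr// -(addr0 0) ltr_leD//.
      by rewrite pmulr_rlt0// -dGE xt_G.
    by rewrite mulr_ge0_le0 ?Gv// subr_ge0.
rewrite leNgt; apply/negP => yv.
have [yd|yd] := leP 0 (pairing y d0).
  have := le0 (2^-1); rewrite invr_gt0 ltr0n invf_le1 ?ltr0n// ler1n => /(_ isT isT).
  by lra.
(* with this step the convex combination equals half of [pairing y v] *)
pose s := pairing y v / (2 * (pairing y v - pairing y d0)).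
have den : 0 < pairing y v - pairing y d0 by lra.
have sE : s * (pairing y v - pairing y d0) = pairing y v / 2.
  by rewrite /s; field; rewrite lt0r_neq0.
have s0 : 0 < s by rewrite /s divr_gt0// mulr_gt0.
have s1 : s <= 1 by rewrite /s ler_pdivrMr ?mulr_gt0//; lra.
by have := le0 s s0 s1; lra.
Qed.

(** The component [y0] maximizes over [K] at [xbar]: it is the functional
    provided by [multipliers] for the convex set [K - xbar]. *)
Lemma normal_cone_multipliers (y : Lq) : normal_cone q1 E xbar y ->
  exists (y0 : Lq) (alpha : 'I_n -> R) (beta : 'I_m -> R) (gamma : 'I_N -> R),
  [/\ (forall i, 0 <= alpha i) /\ (forall i, 0 <= gamma i),
      forall x, K x -> pairing y0 x <= pairing y0 xbar &
      y = y0 + \sum_(i in A) alpha i *: g i + \sum_(j < m) beta j *: h j +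
        \sum_(i in B) gamma i *: dG i].
Proof.
move=> Ny.
have [||c [e [c0 cK]]] := @multipliers R Lp Lq (fun w v => pairing w v)
  (pairingDl pq) (pairingZl pq) (fun w => pairingDr pq w)
  (fun e w => pairingZr pq e w) index constraint C d0 C_convex Cd0 d0_inner
  ineqs eqs y uniq_constraints.
- by apply/feasibleE; split => // i iB; rewrite -dGE ltW// xt_G.
- by move=> v Cv /feasibleE[gv Gv hv]; exact: normal_le0.
pose y0 := y - \sum_(i <- ineqs) c i *: constraint i -
  \sum_(j <- eqs) e j *: constraint j.
exists y0, (fun i => c (inl (inl i))), (fun j => e (inr j)), (fun i => c (inl (inr i))).
split.
- by split => i; exact: c0.
- move=> x Kx; rewrite -subr_le0 -pairingBr//; apply: cK.
  by rewrite /C/= addrC subrK.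
- rewrite /y0 big_cat/= !big_map !big_enum/=.
  rewrite opprD !addrA.
  set S1 := \sum_(i in A) _; set S2 := \sum_(i in B) _; set S3 := \sum_(j < m) _.
  by rewrite (addrAC _ S1 S3) subrK (addrAC _ S1 S2) !subrK.
Qed.

Lemma normal_cone_sum : normal_cone q1 E xbar =
  [set y | exists yK yP yQ, [/\ normal_cone q1 K xbar yK,
    normal_cone q1 P xbar yP, normal_cone q1 Q xbar yQ & y = yK + yP + yQ]].
Proof.
apply/seteqP; split => [y /normal_cone_multipliers|y].
  move=> [y0 [alpha [beta [gamma [[al0 ga0] yK ->]]]]].
  exists y0, (\sum_(i in A) alpha i *: g i + \sum_(j < m) beta j *: h j),
    (\sum_(i in B) gamma i *: dG i); split.
  - by move=> v; exact: tangent_cone_pairing_le.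
  - move=> v; apply: tangent_cone_pairing_le => // z [gz hz].
    case: Exbar => -[_ [gx hx]] _.
    rewrite !pairingDl// !pairing_suml// lerD//.
      apply: ler_sum => i /eqP iA; rewrite !pairingZl// ler_wpM2l// iA.
      exact: gz.
    by under [leRHS]eq_bigr do rewrite pairingZl// hx -hz -pairingZl//.
  - move=> v Qv; rewrite pairing_suml//; apply: sumr_le0 => i /eqP iB.
    rewrite pairingZl// mulr_ge0_le0// -dGE.
    apply: (tangent_cone_diff_le (G_diff i xbar) _ Qv).
    by apply: (@filterE _ _ (nbhs_filter xbar)) => z Qz; rewrite iB; exact: Qz.
  - by rewrite !addrA.
move=> [yK [yP [yQ [NK NP NQ ->]]]] v Ev; rewrite !pairingDl//.
rewrite -(addr0 0) lerD ?(NQ v)//; last by apply: tangent_coneS Ev => z [].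
rewrite -(addr0 0) lerD//.
- by apply: NK; apply: tangent_coneS Ev => z [[]].
- by apply: NP; apply: tangent_coneS Ev => z [[]].
Qed.

Lemma local_minimizer_normal (f : Lp -> R) (df : Lq) : differentiable f xbar ->
  (forall v, 'd f xbar v = pairing df v) -> local_minimizer_on f E xbar ->
  normal_cone q1 E xbar (- df).
Proof.
move=> f_diff dfE [_ fmin] v Ev; rewrite pairingNl// -dfE.
have := tangent_cone_diff_le (differentiableN f_diff) _ Ev; rewrite diffN//; apply.
by apply: filterS fmin => z fz Ez; rewrite lerN2 fz.
Qed.

End constraint_system.

Theorem theorem5p4 (d : measure_display) (T : measurableType d) (R : realType)
    (mu : {sigma_finite_measure set T -> \bar R})
    (p q : \bar R) (p1 : (1 <= p)%E) (q1 : (1 <= q)%E)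
    (pq : (p^-1 + q^-1 = 1)%E)
    (xa xb : T -> \bar R)
    (mxa : measurable_fun [set: T] xa) (mxb : measurable_fun [set: T] xb)
    (n m N : nat)
    (g : 'I_n -> LspaceType mu q1) (a : 'I_n -> R)
    (h : 'I_m -> LspaceType mu q1) (b : 'I_m -> R)
    (f : LspaceType mu p1 -> R) (G : 'I_N -> LspaceType mu p1 -> R)
    (f_diff : forall x, differentiable f x)
    (G_diff : forall i, continuously_differentiable (G i)) :
  let K := box mu p1 xa xb in
  let P := polyhedron g a h b in
  let Q := nonlinear_constraints G in
  let E := K `&` P `&` Q in
  (p = +oo%E -> forall x, (K `&` P) x ->
     in_Lspace_dual q1 ('d f x) /\
     forall i, in_Lspace_dual q1 ('d (G i) x)) ->
  forall xbar : LspaceType mu p1, E xbar ->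
  let A := [pred i | pairing (g i) xbar == a i] in
  let B := [pred i | G i xbar == 0] in
  (exists xt : LspaceType mu p1,
    [/\ \forall t \ae mu, (xa t < (xt t)%:E < xb t)%E,
        forall i, pairing (g i) xt <= a i,
        forall i, i \in B -> 'd (G i) xbar (xt - xbar) < 0 &
        forall j, pairing (h j) xt = b j]) ->
  normal_cone q1 E xbar =
    [set y | exists yK yP yQ, [/\ normal_cone q1 K xbar yK,
      normal_cone q1 P xbar yP, normal_cone q1 Q xbar yQ & y = yK + yP + yQ]]
  /\
  (local_minimizer_on f E xbar ->
   exists (zeta : LspaceType mu q1)
     (alpha : 'I_n -> R) (beta : 'I_m -> R) (gamma : 'I_N -> R),
     [/\ (forall i, i \in A -> 0 <= alpha i) /\
         (forall i, i \in B -> 0 <= gamma i),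
         forall v : LspaceType mu p1,
           'd f xbar v + pairing zeta v
           + \sum_(i in A) alpha i * pairing (g i) v
           + \sum_(j < m) beta j * pairing (h j) v
           + \sum_(i in B) gamma i * 'd (G i) xbar v = 0,
         [/\ \forall t \ae mu,
               xa t = (xbar t)%:E ->
               ((xbar t)%:E < xb t)%E -> zeta t <= 0,
             \forall t \ae mu,
               (xa t < (xbar t)%:E < xb t)%E ->
               zeta t = 0 &
             \forall t \ae mu,
               (xa t < (xbar t)%:E)%E ->
               (xbar t)%:E = xb t -> 0 <= zeta t] &
         exists zeta_a zeta_b : LspaceType mu q1,
           [/\ zeta = zeta_b - zeta_a,
               \forall t \ae mu,
                 zeta_b t = Num.max (zeta t) 0,
               \forall t \ae mu,
                 zeta_a t = Num.max (- zeta t) 0 &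
               \forall t \ae mu,
                 [/\ 0 <= zeta_a t /\ 0 <= zeta_b t,
                     (xa t < (xbar t)%:E)%E ->
                       zeta_a t = 0 &
                     ((xbar t)%:E < xb t)%E ->
                       zeta_b t = 0]]]).
Proof.
move=> K P Q E dual xbar Exbar A B [xt [xt_strict xt_g xt_G xt_h]].
have G_diff' i x : differentiable (G i) x by have [] := G_diff i.
have rep (F : LspaceType mu p1 -> R) : differentiable F xbar ->
    (p = +oo%E -> in_Lspace_dual q1 ('d F xbar)) -> in_Lspace_dual q1 ('d F xbar).
  move=> F_diff; have [poo /(_ poo)//|poo _] := eqVneq p +oo%E.
  have dF_cont : continuous ('d F xbar) by apply: diff_continuous.
  exact: (@Lspace_dual _ _ _ mu p q p1 q1 pq ('d F xbar) poo dF_cont).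
have KPxbar : (K `&` P) xbar by case: Exbar.
have [df dfE] : in_Lspace_dual q1 ('d f xbar).
  by apply: rep => // poo; case: (dual poo _ KPxbar).
have /choice[dG dGE] : forall i, in_Lspace_dual q1 ('d (G i) xbar).
  by move=> i; apply: rep => // poo; case: (dual poo _ KPxbar).
have Kxbar : K xbar by case: KPxbar.
split.
  exact: (normal_cone_sum pq mxa mxb G_diff' Exbar dGE xt_strict xt_g xt_G xt_h).
move=> fmin.
have Ndf := local_minimizer_normal pq (f_diff xbar) dfE fmin.
have [zeta [alpha [beta [gamma [[al0 ga0] zmax dfN]]]]] :=
  normal_cone_multipliers pq mxa mxb G_diff' Exbar dGE xt_strict xt_g xt_G xt_h Ndf.
have sgn := box_maximizer_sign pq mxa mxb Kxbar zmax.
exists zeta, alpha, beta, gamma; split.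
- by split => i _.
- move=> v; rewrite dfE.
  have -> : df = - (- df) by rewrite opprK.
  rewrite dfN pairingNl// !pairingDl// !pairing_suml//.
  under [X in - (_ + X + _ + _)]eq_bigr do rewrite pairingZl//.
  under [X in - (_ + _ + X + _)]eq_bigr do rewrite pairingZl//.
  under [X in - (_ + _ + _ + X)]eq_bigr do rewrite pairingZl// -dGE.
  by rewrite -!addrA addNr.
- split; apply: filterS sgn => t [zb za].
  + by move=> _; exact: zb.
  + by move=> /andP[/za z0 /zb z1]; apply/eqP; rewrite eq_le z0 z1.
  + by move=> /za.
- have mzeta := Lval_measurable zeta; have zetaq := Lval_Lfun zeta.
  have max_Lfun (e : R) : `|e| = 1 ->
      (fun t => Num.max (e * zeta t) 0) \in Lfun mu q.
    move=> e1; apply: (Lfun_le q1 _ zetaq).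
      by apply: measurable_maxr => //; exact: measurable_funM.
    apply: aeW => t; rewrite ger0_norm ?le_max ?lexx ?orbT// ge_max normr_ge0 andbT.
    by rewrite (le_trans (ler_norm _))// normrM e1 mul1r.
  have bE : \forall t \ae mu, Lclass mu q1 (fun t => Num.max (1 * zeta t) 0) t =
      Num.max (zeta t) 0.
    by apply: filterS (LclassE q1 (max_Lfun 1 (normr1 _))) => t ->; rewrite mul1r.
  have aE : \forall t \ae mu, Lclass mu q1 (fun t => Num.max (-1 * zeta t) 0) t =
      Num.max (- zeta t) 0.
    have N1 : `|-1| = 1 :> R by rewrite normrN1.
    by apply: filterS (LclassE q1 (max_Lfun (-1) N1)) => t ->; rewrite mulN1r.
  set zb := Lclass _ _ _ in bE; set za := Lclass _ _ _ in aE.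
  exists za, zb; split => //.
  + apply/Lval_eqP; near=> t; rewrite (near (Lval_sub zb za) t)//.
    rewrite (near bE t)// (near aE t)// /Num.max oppr_lt0.
    by case: ltgtP => h_; rewrite ?subr0 ?sub0r ?opprK// h_ ?oppr0 ?addr0.
  + near=> t; have [tb ta] : (((xbar t)%:E < xb t)%E -> zeta t <= 0) /\
      ((xa t < (xbar t)%:E)%E -> 0 <= zeta t) by near: t; exact: sgn.
    have -> : za t = Num.max (- zeta t) 0 by near: t; exact: aE.
    have -> : zb t = Num.max (zeta t) 0 by near: t; exact: bE.
    split; first by rewrite !le_max !lexx !orbT.
      by move=> /ta z0; apply/max_idPr; rewrite oppr_le0.
    by move=> /tb z0; apply/max_idPr.
Unshelve. all: by end_near. Qed.
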